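(* Let $d\ge2$, $p>1$, $q>1$, $s\in(0,1)$ with $sp\le d$, let $k\in\mathbb{N}$ with $1\le k<d$, and let $\alpha,\beta\in\mathbb{R}$. Define $\theta=d+(sp-d)\frac{q}{p}$. If $sp<d$, assume $p<q\le\frac{dp}{d-sp}$; if $sp=d$, assume $q>p$. Then there exists a constant $C=C(d,s,p,q,k,\alpha,\beta)>0$ such that for all $u\in C^1_c(\mathbb{R}^d)$ $$\left(\int_{\mathbb{R}^d}\int_{\mathbb{R}^d}\frac{|u(x)-u(y)|^p}{|x-y|^{d+sp}}\,|x_k|^{-(k-\alpha+\beta-sp)/2}\,|y_k|^{-(k+\alpha-\beta-sp)/2}\,dx\,dy\right)^{\frac1p}\ \ge\ C\left(\int_{\mathbb{R}^d}\frac{|u(x)|^q}{|x_k|^{\theta+(k-sp)\frac qp}}\,dx\right)^{\frac1q}.$$ Furthermore, for any $q'$ satisfying $2<q'\le\frac{2d}{d-2s}$ and any $r>1$, with $\theta'=d+(2s-d)\frac{q'}{2}$, there exists a constant $C=C(d,s,r,q',k,\alpha,\beta)>0$ such that for all $u\in C^1_c(\mathbb{R}^d)$ $$\left(\int_{\mathbb{R}^d}\int_{\mathbb{R}^d}\frac{|u(x)-u(y)|^2}{|x-y|^{d+2s}}\,W_r(x,y)\,|x_k|^\alpha|y_k|^\beta\,dx\,dy\right)^{\frac12}\ \ge\ C\left(\int_{\mathbb{R}^d}\frac{|u(x)|^{q'}}{|x_k|^{\theta'+(k-2s)\frac{q'}{2}}}\,dx\right)^{\frac1{q'}},$$ where $$W_r(x,y)=\min\left\{|x_k|^{-\frac{k+\alpha+\beta-2s}{r}},|y_k|^{-\frac{k+\alpha+\beta-2s}{r}}\right\}\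 \max\left\{|x_k|^{-\frac{k+\alpha+\beta-2s}{r}},|y_k|^{-\frac{k+\alpha+\beta-2s}{r}}\right\}^{r-1}.$$
   Context: Functions are real-valued. For $x\in\mathbb{R}^d$ write $x=(x_k,x_{d-k})$ with $x_k\in\mathbb{R}^k$, $x_{d-k}\in\mathbb{R}^{d-k}$. $C^1_c(\mathbb{R}^d)$ denotes the compactly supported $C^1$ functions on $\mathbb{R}^d$. The left-hand sides may be $+\infty$, in which case the inequalities are trivial. *)

(* Defs.v *)
From HB Require Import structures.
From mathcomp Require Import all_boot all_order all_algebra.
From mathcomp Require Import all_classical all_reals all_analysis.

Set Implicit Arguments.
Unset Strict Implicit.
Unset Printing Implicit Defensive.
Import Order.TTheory GRing.Theory Num.Theory.
Import numFieldNormedType.Exports.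

Local Open Scope classical_set_scope.
Local Open Scope ring_scope.

(* MathComp-Analysis has no Lebesgue measure on R^n.  We equip 'rV[R]_n with
   the product sigma-algebra (the one generated by the coordinates, i.e. the
   Borel one) and transport the iterated product of the one-dimensional
   Lebesgue measure to it; [lebesgue_rV_box] characterizes the result. *)

Definition rV_display : Type -> measure_display.
Proof. exact. Qed.

Section measurable_rV.
Context {R : realType} (n : nat).

Definition rV_coord (i : 'I_n) (x : 'rV[R]_n) : measurableTypeR R := x ord0 i.

Let rV_set0 : g_sigma_preimage rV_coord set0.
Proof. exact: sigma_algebra0. Qed.

Let rV_setC A : g_sigma_preimage rV_coord A -> g_sigma_preimage rV_coord (~` A).
Proof. exact: sigma_algebraC. Qed.

Let rV_bigcup (F : (set 'rV[R]_n)^nat) :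
  (forall i, g_sigma_preimage rV_coord (F i)) ->
  g_sigma_preimage rV_coord (\bigcup_i (F i)).
Proof. exact: sigma_algebra_bigcup. Qed.

HB.instance Definition _ :=
  @isMeasurable.Build (rV_display R)
    'rV[R]_n (g_sigma_preimage rV_coord) rV_set0 rV_setC rV_bigcup.

End measurable_rV.

Section measurable_rV_lemmas.
Context {R : realType}.

Lemma measurable_rV_coord n (i : 'I_n) :
  measurable_fun [set: 'rV[R]_n] (@rV_coord R n i).
Proof.
move=> _ Y mY; rewrite setTI; apply: sub_sigma_algebra => /=.
rewrite -bigcup_seq/=; exists i => /=; first by rewrite mem_index_enum.
by exists Y => //; rewrite setTI.
Qed.

Lemma measurable_fun_rVP d (T : measurableType d) n (f : T -> 'rV[R]_n) :
  (forall i, measurable_fun [set: T] (@rV_coord R n i \o f)) ->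
  measurable_fun [set: T] f.
Proof.
move=> mf _ A mA; rewrite setTI.
have : smallest (sigma_algebra [set: 'rV[R]_n])
    (\big[setU/set0]_(i < n) preimage_set_system setT (@rV_coord R n i)
       measurable) `<=` image_set_system setT f measurable.
  apply: smallest_sub.
    exact: sigma_algebra_image (sigma_algebra_measurable T).
  rewrite -bigcup_seq => B [i _ [C mC <-]].
  rewrite /image_set_system/= !setTI -comp_preimage.
  by rewrite -[X in measurable X]setTI; exact: mf.
by move=> /(_ A mA); rewrite /image_set_system/= setTI.
Qed.

Definition rV_cons n (p : measurableTypeR R * 'rV[R]_n) : 'rV[R]_n.+1 :=
  \row_i oapp (p.2 ord0) p.1 (unlift ord0 i).

Lemma measurable_rV_cons n : measurable_fun setT (@rV_cons n).
Proof.
apply: measurable_fun_rVP => i.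
case: (unliftP ord0 i) => [j|] ->.
  rewrite [X in measurable_fun _ X](_ : _ = @rV_coord R n j \o snd).
    by apply: measurableT_comp => //; exact: measurable_rV_coord.
  by apply/funext => p; rewrite /rV_coord/= mxE liftK.
rewrite [X in measurable_fun _ X](_ : _ = fst)//.
by apply/funext => p; rewrite /rV_coord/= mxE unlift_none.
Qed.

Definition rV_uncons n (x : 'rV[R]_n.+1) : measurableTypeR R * 'rV[R]_n :=
  (x ord0 ord0, \row_j x ord0 (lift ord0 j)).

Lemma rV_consK n : cancel (@rV_cons n) (@rV_uncons n).
Proof.
move=> [a x]; congr pair; first by rewrite mxE unlift_none.
by apply/rowP => j; rewrite !mxE liftK.
Qed.

Lemma rV_unconsK n : cancel (@rV_uncons n) (@rV_cons n).
Proof.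
move=> x; apply/rowP => i; rewrite mxE.
by case: (unliftP ord0 i) => [j|] -> /=; rewrite ?mxE.
Qed.

Lemma measurable_rV_uncons n : measurable_fun setT (@rV_uncons n).
Proof.
apply: measurable_fun_pair; first exact: measurable_rV_coord.
apply: measurable_fun_rVP => i.
rewrite [X in measurable_fun _ X](_ : _ = rV_coord (lift ord0 i)).
  exact: measurable_rV_coord.
by apply/funext => x; rewrite /rV_coord/= mxE.
Qed.

End measurable_rV_lemmas.

Section lebesgue_rV.
Context {R : realType}.

Section step.
Context n (mu : {sigma_finite_measure set 'rV[R]_n -> \bar R}).

Definition lebesgue_rV_step : set 'rV[R]_n.+1 -> \bar R :=
  pushforward (@lebesgue_measure R \x mu)%E (@rV_cons R n).

Let lebesgue_rV_step0 : lebesgue_rV_step set0 = 0%E.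
Proof. by rewrite /lebesgue_rV_step /pushforward preimage_set0 measure0. Qed.

Let lebesgue_rV_step_ge0 A : (0 <= lebesgue_rV_step A)%E.
Proof. by rewrite /lebesgue_rV_step /pushforward; exact: measure_ge0. Qed.

Let lebesgue_rV_step_sigma_additive : semi_sigma_additive lebesgue_rV_step.
Proof.
move=> F mF tF mUF; rewrite /lebesgue_rV_step /pushforward preimage_bigcup.
apply: measure_semi_sigma_additive.
- by move=> k; rewrite -[X in measurable X]setTI; exact: measurable_rV_cons.
- apply/trivIsetP => i j _ _ ij; rewrite -preimage_setI.
  by move/trivIsetP : tF => /(_ _ _ _ _ ij) ->//; rewrite preimage_set0.
- rewrite -preimage_bigcup -[X in measurable X]setTI.
  exact: measurable_rV_cons.
Qed.

HB.instance Definition _ := isMeasure.Build _ _ _ lebesgue_rV_step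
  lebesgue_rV_step0 lebesgue_rV_step_ge0 lebesgue_rV_step_sigma_additive.

Let lebesgue_rV_step_sigma_finite : sigma_finite setT lebesgue_rV_step.
Proof.
have /sigma_finiteP[F [TF ndF Foo]] := sigma_finiteT (@lebesgue_measure R).
have /sigma_finiteP[G [TG ndG Goo]] := sigma_finiteT mu.
exists (fun k => @rV_uncons R n @^-1` (F k `*` G k)).
  rewrite -preimage_bigcup -(@preimage_setT _ _ (@rV_uncons R n)).
  congr (_ @^-1` _); rewrite -setXTT TF TG predeqE => -[x y]; split.
    move=> [/= [i _ Fix] [j _ Gjy]]; exists (maxn i j) => //; split.
    - by move: x Fix; exact/subsetPset/ndF/leq_maxl.
    - by move: y Gjy; exact/subsetPset/ndG/leq_maxr.
  by move=> [i _ []/= ? ?]; split; exists i.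
move=> k; have [mF Fk] := Foo k; have [mG Gk] := Goo k; split.
  rewrite -[X in measurable X]setTI.
  by apply: measurable_rV_uncons => //; exact: measurableX.
rewrite /lebesgue_rV_step /pushforward -comp_preimage.
rewrite (_ : _ \o _ = id); last by rewrite funeqE => p /=; rewrite rV_consK.
by rewrite preimage_id product_measure1E// lte_mul_pinfty// ge0_fin_numE.
Qed.

HB.instance Definition _ := Measure_isSigmaFinite.Build _ _ _
  lebesgue_rV_step lebesgue_rV_step_sigma_finite.

End step.

Fixpoint lebesgue_rV n : {sigma_finite_measure set 'rV[R]_n -> \bar R} :=
  match n return {sigma_finite_measure set 'rV[R]_n -> \bar R} with
  | 0 => @dirac _ 'rV[R]_0 0%R R
  | m.+1 => lebesgue_rV_step (lebesgue_rV m)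
  end.

Lemma measurable_rV_box n (A : 'I_n -> set (measurableTypeR R)) :
  (forall i, measurable (A i)) ->
  measurable [set x : 'rV[R]_n | forall i, A i (x ord0 i)].
Proof.
move=> mA; rewrite [X in measurable X](_ : _ =
    \bigcap_(i in [set: 'I_n]) (@rV_coord R n i @^-1` A i)).
  apply: fin_bigcap_measurable => // i _.
  by rewrite -[X in measurable X]setTI; exact: measurable_rV_coord.
by apply/seteqP; split => [x Ax i _|x Ax i]; exact: Ax.
Qed.

Lemma lebesgue_rV_box n (A : 'I_n -> set (measurableTypeR R)) :
  (forall i, measurable (A i)) ->
  lebesgue_rV n [set x | forall i, A i (x ord0 i)] =
  (\prod_(i < n) lebesgue_measure (A i))%E.
Proof.
elim: n A => [|n IHn] A mA.
  rewrite big_ord0 /= diracE mem_set//=; by case.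
rewrite big_ord_recl -IHn; last by move=> i; exact: mA.
have mB : measurable [set x : 'rV[R]_n | forall i, A (lift ord0 i) (x ord0 i)].
  by apply: (@measurable_rV_box _ (A \o lift ord0)) => i; exact: mA.
rewrite -(product_measure1E (@lebesgue_measure R) (lebesgue_rV n) (mA ord0) mB).
rewrite [in LHS]/= /lebesgue_rV_step /pushforward; congr (_ _).
apply/seteqP; split => [[a x]/= Ax|[a x]/= [Aa Ax] i].
  split; first by have := Ax ord0; rewrite mxE unlift_none.
  by move=> i; have := Ax (lift ord0 i); rewrite mxE liftK.
by rewrite mxE; case: (unliftP ord0 i) => [j|] ->.
Qed.

End lebesgue_rV.

Section weighted_seminorm.
Context {R : realType} {d : nat}.
Implicit Types (u : 'rV[R]_d -> R) (x y : 'rV[R]_d).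

(* The library norm on 'rV[R]_d is the sup norm. *)
Definition enorm x : R := Num.sqrt (\sum_(i < d) x ord0 i ^+ 2).

(* |x_k| for x = (x_k, x_{d-k}), x_k consisting of the first k coordinates *)
Definition head_norm (k : nat) x : R :=
  Num.sqrt (\sum_(i < d | (i < k)%N) x ord0 i ^+ 2).

Definition C1 u : Prop :=
  (forall x, differentiable u x) /\ (forall v, continuous ('D_v u)).

Definition compactly_supported u : Prop := compact (closure [set x | u x != 0]).

Definition C1c u : Prop := C1 u /\ compactly_supported u.

(* \iint |u(x) - u(y)|^p / |x - y|^(d + sp) w(x, y) dx dy; the diagonal is
   null, so the value of the integrand there is irrelevant. *)
Definition weighted_gagliardo (s p : R) (w : 'rV[R]_d -> 'rV[R]_d -> R) u :
    \bar R :=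
  (\int[lebesgue_rV d]_y \int[lebesgue_rV d]_x
     (`|u x - u y| `^ p / enorm (x - y) `^ (d%:R + s * p) * w x y)%:E)%E.

Definition weighted_power_integral (q gamma : R) (k : nat) u : \bar R :=
  (\int[lebesgue_rV d]_x (`|u x| `^ q / head_norm k x `^ gamma)%:E)%E.

(* e stands for k + alpha + beta - 2s *)
Definition Wr (e r : R) (k : nat) x y : R :=
  Num.min (head_norm k x `^ (- (e / r))) (head_norm k y `^ (- (e / r))) *
  Num.max (head_norm k x `^ (- (e / r))) (head_norm k y `^ (- (e / r)))
    `^ (r - 1).

End weighted_seminorm.

(* Main.v *)
Require Import Defs.
From mathcomp Require Import all_boot all_order all_algebra.
From mathcomp Require Import all_classical all_reals all_analysis.
From mathcomp Require Import measurable_realfun.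
From mathcomp Require Import ring lra.
Set Implicit Arguments.
Unset Strict Implicit.
Unset Printing Implicit Defensive.
Import Order.TTheory GRing.Theory Num.Theory.
Import numFieldNormedType.Exports.
Local Open Scope classical_set_scope.
Local Open Scope ring_scope.

(* Write rho(y) = |y_k|, let D double the first k coordinates, and let F(y) be
   the inner integral of the Gagliardo energy E, so that E = \int F.  The
   weights only enter through the bound w(x, y) >= c rho^(sp - k) when |x_k| and
   |y_k| are comparable to rho; the weight on the right is rho^-gamma with
   gamma = d - (d - k) q / p < k.

   For cubes Q_m of side ~ 2^-m rho at y and a cube Q' of side ~ rho at D y, the
   averages A of u satisfy |u(y) - A_m|^p <~ 2^(-msp) rho^k F(y), and
   |A_m - A_(m+1)|^p <~ 2^(m(d - sp)) rho^(k-d) E, and likewise for Q' with m = 0.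
   Choosing the scale m that balances the two bounds (Hedberg's trick) gives
   |u(y) - A_(Q')|^q rho^-gamma <~ E^(q/p - 1) F(y).  The same bound at D y,
   where Q' is the largest cube, controls u - u o D.  Finally, gamma < k makes
   composition with D a strict contraction of L^q(rho^-gamma), so ||u|| is
   controlled by ||u - u o D||; the integrals are restricted to {rho >= t}, where
   they are finite, and t tends to 0. *)

(** * Real powers *)

Section real_powers.
Context {R : realType}.
Implicit Types (a b c p q r s t x y : R).

Lemma powR_gt0E x a : 0 < x -> x `^ a = expR (a * ln x).
Proof. by move=> x0; rewrite /powR gt_eqF. Qed.

Lemma le_powR r x y : 0 <= r -> 0 <= x -> x <= y -> x `^ r <= y `^ r.
Proof.
move=> r0 x0 xy; apply: ge0_ler_powR => //; rewrite nnegrE//.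
exact: le_trans xy.
Qed.

(** The logarithms of [x] and [t] differ by at most [ln c], which costs a factor [c^|a|] whatever
    the sign of [a]. *)
Lemma powR_comparable c x t a : 0 < x -> 1 <= c -> x / c <= t <= c * x ->
  c `^ (- `|a|) * x `^ a <= t `^ a.
Proof.
move=> x0 c1 /andP[xt tx].
have c0 : 0 < c by exact: lt_le_trans c1.
have t0 : 0 < t by apply: lt_le_trans xt; exact: divr_gt0.
rewrite !powR_gt0E// -expRD ler_expR -lerBrDr -mulrBr mulNr lerNl.
have : `|ln x - ln t| <= ln c.
  rewrite ler_distl; apply/andP; split.
    by rewrite lerBlDr -lnM ?posrE// ler_ln ?posrE ?mulr_gt0// mulrC.
  by rewrite -lnM ?posrE// ler_ln ?posrE ?mulr_gt0// -ler_pdivrMr.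
move=> xtc; rewrite -mulrN opprB.
by rewrite (le_trans (ler_norm _))// normrM ler_wpM2l// distrC.
Qed.

(** Either [|a - b| <= c |b|] or [|b| < |a - b| / c]. The coefficient of [|b|^q] can be brought as
    close to 1 as desired, which the final absorption needs. *)
Lemma powR_norm_split q c a b : 0 < q -> 0 < c ->
  `|a| `^ q <= (1 + c) `^ q * `|b| `^ q + (1 + c^-1) `^ q * `|a - b| `^ q.
Proof.
move=> q0 c0; have ci0 : 0 < c^-1 by rewrite invr_gt0.
have c10 : 0 <= 1 + c by rewrite addr_ge0// ltW.
have ci10 : 0 <= 1 + c^-1 by rewrite addr_ge0// ltW.
have tri : `|a| <= `|b| + `|a - b|.
  by rewrite -{1}[a](subrKC b) (le_trans (ler_normD _ _))// addrC.
rewrite -!powRM//; have [ab|ab] := leP `|a - b| (c * `|b|).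
  apply: ler_wpDr; first exact: powR_ge0.
  apply: le_powR => //; first exact: ltW.
  by rewrite (le_trans tri)// mulrDl mul1r lerD2l.
apply: ler_wpDl; first exact: powR_ge0.
apply: le_powR => //; first exact: ltW.
rewrite (le_trans tri)// mulrDl mul1r addrC lerD2l mulrC ler_pdivlMr//.
by rewrite mulrC ltW.
Qed.

Lemma powR_normB_le q a b c : 0 < q ->
  `|a - b| `^ q <= 2 `^ q * (`|a - c| `^ q + `|b - c| `^ q).
Proof.
move=> q0; have := powR_norm_split (a - b) (c - b) q0 (@ltr01 R).
by rewrite invr1 (_ : a - b - (c - b) = a - c) ?(distrC c b); [lra|ring].
Qed.

(* Choosing [t = (E X^p)^(1/p)] after taking expectations, this replaces
   Jensen's inequality up to a factor 2. *)
Lemma ler_addl_powR p t x : 1 <= p -> 0 < t -> 0 <= x ->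
  x <= t + t `^ (1 - p) * x `^ p.
Proof.
move=> p1 t0 x0; have [xt|tx] := leP x t.
  by rewrite ler_wpDr// mulr_ge0// powR_ge0.
apply: ler_wpDl; first exact: ltW.
have {}x0 : 0 < x by exact: lt_trans tx.
rewrite -(mulr_powRB1 (ltW x0)) ?(lt_le_trans ltr01)// mulrCA ler_peMr ?(ltW x0)//.
rewrite -(opprB p 1) powRN mulrC ler_pdivlMr ?powR_gt0// mul1r.
by rewrite le_powR ?subr_ge0// ltW.
Qed.

(* The scale [2^-m] at which both bounds on [u - A m] and [A m - B] balance is
   [2^(D m) ~ h]; this is Hedberg's optimization. *)
Lemma hedberg_optimization p q s D (K := 2 `^ s + (1 + (2 `^ (D / q) - 1)^-1))
    C X h (u B : R) (A : nat -> R) :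
    0 < p -> p < q -> 0 < s -> 0 < D -> D / p - s <= D / q ->
    0 <= C -> 0 <= X -> 0 <= h ->
    `|u - B| <= C * (X * h `^ p^-1) ->
    (forall m, `|u - A m| <= C * ((2 `^ (- s)) ^+ m * (X * h `^ p^-1))) ->
    (forall m, `|A m - A m.+1| <= C * ((2 `^ (D / q)) ^+ m * X)) ->
    `|A 0%N - B| <= C * X ->
  `|u - B| <= C * K * (X * h `^ q^-1).
Proof.
move=> p0 pq s0 D0 Dpq C0 X0 h0 uB uA AA AB.
have q0 : 0 < q by exact: lt_trans pq.
have b0 : 0 < ln 2 :> R by rewrite ln_gt0// ltr1n.
set b := ln 2 : R in b0.
have T1 : 1 < 2 `^ (D / q) :> R.
  by rewrite powR_gt0E// expR_gt1 mulr_gt0// divr_gt0.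
set T := 2 `^ (D / q) in T1 K uB uA AA AB *.
have iT0 : 0 < (T - 1)^-1 by rewrite invr_gt0 subr_gt0.
have s1 : 1 <= 2 `^ s :> R.
  by rewrite powR_gt0E// ltW// expR_gt1 mulr_gt0.
have K1 : 1 <= K by rewrite /K ler_wpDr// addr_ge0// ltW.
(* For [h <= 1] the direct bound suffices, as [h^(1/p) <= h^(1/q)]. *)
have [h1|h1] := leP h 1.
  rewrite (le_trans uB)// -mulrA ler_wpM2l//.
  rewrite -[leLHS]mul1r ler_pM ?mulr_ge0 ?powR_ge0//.
  rewrite ler_wpM2l//; move: h0; rewrite le_eqVlt => /predU1P[<-|h0].
    by rewrite !powR0 ?invr_neq0 ?gt_eqF.
  by rewrite ger_powR ?h0// lef_pV2 ?posrE// ltW.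
have {}h0 : 0 < h by exact: lt_trans h1.
(* The balancing scale is the real [t] with [2^(D t) = h]; [m] below is its integer part, and
   rounding down costs the factor [2^s]. *)
pose t := ln h / (D * b).
have hE : ln h = D * b * t by rewrite /t mulrC divfK// mulf_neq0 ?gt_eqF.
have t0 : 0 <= t by rewrite divr_ge0 ?ln_ge0 ?mulr_ge0// ltW.
have /andP[mt tm] := truncn_itv t0.
set m := Num.truncn t in mt tm.
(* Telescoping from [A 0] gives a geometric sum of ratio [T > 1]. The constant [1 + (T - 1)^-1]
   closes the induction since its product with [T - 1] is [T >= 1]. *)
have AmB i : `|A i - B| <= C * X * ((1 + (T - 1)^-1) * T ^+ i).
  elim: i => [|i IHi].
    rewrite expr0 mulr1 (le_trans AB)// ler_peMr ?mulr_ge0//.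
    by rewrite lerDl ltW.
  rewrite (_ : A i.+1 - B = (A i - B) - (A i - A i.+1)); last by ring.
  rewrite (le_trans (ler_normB _ _))// (le_trans (lerD IHi (AA i)))//.
  have -> : C * X * ((1 + (T - 1)^-1) * T ^+ i.+1) =
      C * X * T ^+ i * ((1 + (T - 1)^-1) * (T - 1) + (1 + (T - 1)^-1)).
    rewrite exprS; ring.
  have -> : (1 + (T - 1)^-1) * (T - 1) = T.
    by rewrite mulrDl mul1r mulVf ?subrK// subr_eq0 gt_eqF.
  rewrite [leLHS](_ : _ = C * X * T ^+ i * (1 + (1 + (T - 1)^-1))); last by ring.
  rewrite ler_wpM2l ?mulr_ge0 ?exprn_ge0//.
    by rewrite ltW// (lt_trans ltr01).
  by rewrite lerD2r ltW.
rewrite (_ : u - B = (u - A m) + (A m - B)); last by ring.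
rewrite (le_trans (ler_normD _ _))//.
have -> : C * K * (X * h `^ q^-1) =
    C * X * (2 `^ s * h `^ q^-1) + C * X * ((1 + (T - 1)^-1) * h `^ q^-1).
  by rewrite /K; ring.
rewrite lerD//.
  rewrite (le_trans (uA m))// -[leRHS]mulrA ler_wpM2l// mulrCA ler_wpM2l//.
  rewrite -powR_mulrn ?powR_ge0// -powRrM !powR_gt0E// -!expRD ler_expR -/b hE.
  have -> : - s * m%:R * b + p^-1 * (D * b * t) = b * (- s * m%:R + D / p * t).
    by ring.
  have -> : s * b + q^-1 * (D * b * t) = b * (s + D / q * t) by ring.
  rewrite ler_wpM2l ?(ltW b0)//.
  have : s * t <= s * (m.+1)%:R by rewrite ler_wpM2l// ltW// ltW.
  have : (D / p - s) * t <= D / q * t by rewrite ler_wpM2r.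
  by rewrite mulrBl -natr1 mulrDr mulr1 mulNr; lra.
rewrite (le_trans (AmB m))// ler_wpM2l ?mulr_ge0// ler_wpM2l//.
  by rewrite addr_ge0// ltW.
rewrite /T -powR_mulrn ?powR_ge0// -powRrM !powR_gt0E// ler_expR -/b hE.
have -> : q^-1 * (D * b * t) = D / q * b * t by ring.
by rewrite mulrAC ler_wpM2l// mulr_ge0 ?divr_ge0// ltW.
Qed.

End real_powers.

(** * Lebesgue measure on 'rV[R]_n *)

Section rV_measure_theory.
Context {R : realType}.

(** The sigma-algebra comes from the coordinates, not from the topology: an open set is recovered as
    the countable union of the boxes with rational centre and half-side [1/(m+1)] that it
    contains. *)
Lemma open_measurable_rV n (A : set 'rV[R]_n) : open A -> measurable A.
Proof.
move=> oA.
pose box (vm : 'rV[rat]_n * nat) : set 'rV[R]_n :=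
  [set x | forall i, `]ratr (vm.1 ord0 i) - vm.2.+1%:R^-1,
                       ratr (vm.1 ord0 i) + vm.2.+1%:R^-1[%classic (x ord0 i)].
pose F vm := if pselect (box vm `<=` A) then box vm else set0.
have -> : A = \bigcup_vm F vm.
  apply/seteqP; split=> [x Ax|x [vm _]]; last first.
    by rewrite /F; case: pselect => [boxA /= xvm|_ []]; exact: boxA.
  have /nbhs_ballP[e /= e0 xeA] : nbhs x A by exact: open_nbhs_nbhs.
  pose m := Num.truncn (2 / e).
  have me : 2 * m.+1%:R^-1 < e.
    by rewrite ltr_pdivrMr// mulrC -ltr_pdivrMr// truncnS_gt.
  have m0 : 0 < m.+1%:R^-1 :> R by rewrite invr_gt0.
  have /choice[v vP] i : exists r : rat,
      ratr r \in `]x ord0 i - m.+1%:R^-1, x ord0 i + m.+1%:R^-1[.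
    by apply: rat_in_itvoo; rewrite ltrD2l gtrN.
  pose vm := (\row_i v i, m).
  have xvm : box vm x.
    move=> i; move: (vP i); rewrite /= !mxE !in_itv/=.
    by move: m.+1%:R^-1 => z /andP[? ?]; apply/andP; split; lra.
  exists vm => //; rewrite /F; case: pselect => [//|boxA].
  exfalso; apply: boxA => y yvm; apply: xeA; split => // i j.
  rewrite (ord1 i) /ball/= ltr_norml.
  have := yvm j; have := xvm j; rewrite /= !in_itv/=; move: me.
  by move: m.+1%:R^-1 => z ? /andP[? ?] /andP[? ?]; apply/andP; split; lra.
apply: countable_bigcupT_measurable => [|vm]; first exact: countableP.
rewrite /F; case: pselect => [boxA|nboxA] /=; last exact: measurable0.
exact: (@measurable_rV_box R n (fun i => `]ratr (vm.1 ord0 i) - vm.2.+1%:R^-1,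
                       ratr (vm.1 ord0 i) + vm.2.+1%:R^-1[%classic)).
Qed.

Lemma continuous_measurable_rV n (u : 'rV[R]_n -> R) :
  continuous u -> measurable_fun setT u.
Proof.
move=> /continuousP cu; apply: (measurability _ (RGenOpens.measurableE R)).
move=> _ [_ [a [b ->] <-]]; rewrite setTI; apply: open_measurable_rV.
exact/cu/interval_open.
Qed.

(** Bounded values make the averages of [u] meaningful, and a bounded support makes the truncated
    power integral finite. *)
Lemma C1c_bounded n (u : 'rV[R]_n -> R) : C1c u ->
  exists2 M, 0 < M & forall x,
    `|u x| <= M /\ (u x != 0 -> forall i, `|x ord0 i| <= M).
Proof.
move=> [[du _] cptu].
have cu : continuous u by move=> x; exact: differentiable_continuous.
have [M1 [_ M1P]] := compact_bounded cptu.
have [M2 [_ M2P]] := compact_bounded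
  (continuous_compact (continuous_subspaceT cu) cptu).
have N1 := normr_ge0 M1; have N2 := normr_ge0 M2.
exists (1 + `|M1| + `|M2|); first by lra.
have {}M1P := M1P (1 + `|M1| + `|M2|).
have {}M2P := M2P (1 + `|M1| + `|M2|).
move=> x; have [ux0|ux0] := eqVneq (u x) 0.
  by rewrite ux0 normr0; split => //; rewrite !addr_ge0.
have cx : closure [set x | u x != 0] x by exact: subset_closure.
split; first by apply: M2P; [have := ler_norm M2; lra|exists x].
move=> _ i; apply: le_trans (M1P _ x cx); last by have := ler_norm M1; lra.
by rewrite [leRHS]/Num.norm/= mx_normrE (le_bigmax _ _ (ord0, i)).
Qed.

Local Open Scope ereal_scope.

Lemma ge0_integral_rV_cons n (f : 'rV[R]_n.+1 -> \bar R) :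
    measurable_fun setT f -> (forall x, 0 <= f x) ->
  \int[lebesgue_rV n.+1]_x f x =
  \int[lebesgue_measure]_a \int[lebesgue_rV n]_x f (rV_cons (a, x)).
Proof.
move=> mf f0.
rewrite [LHS](@ge0_integral_pushforward _ _ _ _ _ _ (@measurable_rV_cons R n) _
  setT f)//.
rewrite preimage_setT.
apply: (@fubini_tonelli1 _ _ _ _ _ lebesgue_measure (lebesgue_rV n)
  (f \o @rV_cons R n)) => [|x]; last exact: f0.
by apply: measurableT_comp => //; exact: measurable_rV_cons.
Qed.

Lemma measurable_fun_integral_rV_cons n (f : 'rV[R]_n.+1 -> \bar R) :
    measurable_fun setT f -> (forall x, 0 <= f x) ->
  measurable_fun setT (fun a => \int[lebesgue_rV n]_x f (rV_cons (a, x))).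
Proof.
move=> mf f0.
apply: (@measurable_fun_fubini_tonelli_F _ _ _ _ _ (lebesgue_rV n)
  (f \o @rV_cons R n)).
  by apply: measurableT_comp => //; exact: measurable_rV_cons.
by move=> x; exact: f0.
Qed.

(** By uniqueness of Lebesgue measure: [c] times its push-forward under [x -> c x] gives each
    half-open interval its length. *)
Lemma ge0_integral_dilation1 (c : R) (f : R -> \bar R) : (0 < c)%R ->
    measurable_fun setT f -> (forall x, 0 <= f x) ->
  \int[lebesgue_measure]_x f (c * x)%R = c^-1%:E * \int[lebesgue_measure]_x f x.
Proof.
move=> c0 mf f0.
pose m : measurableTypeR R -> measurableTypeR R := *%R c.
have mc : measurable_fun setT m by exact: measurable_funM.
have ci0 : (0 <= c^-1)%R by rewrite invr_ge0 ltW.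
transitivity (\int[pushforward lebesgue_measure m]_x f x).
  by rewrite (@ge0_integral_pushforward _ _ _ _ _ _ mc _ setT f).
rewrite -(@ge0_integral_mscale _ _ _ lebesgue_measure setT measurableT 
  (NngNum ci0) f)//.
apply: eq_measure_integral => A mA _.
pose mu : {measure set (measurableTypeR R) -> \bar R} :=
  mscale (NngNum (ltW c0)) (pushforward lebesgue_measure m).
have : lebesgue_measure A = mu mc A.
  apply: lebesgue_measure_unique => // X /ocitvP[->|[[a b] /= ab ->]].
    by rewrite !measure0.
  rewrite /mu /= /mscale/= /pushforward.
  rewrite (_ : _ @^-1` _ = `]c^-1 * a, c^-1 * b]%classic)%R; last first.
    apply/seteqP; split => x /=; rewrite !in_itv/=;
      by rewrite ltr_pdivrMl// ler_pdivlMl.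
  rewrite !lebesgue_measure_itv/= !lte_fin ltr_pM2l ?invr_gt0// ab.
  by rewrite -EFinB -EFinM -mulrBr mulVKf// gt_eqF.
rewrite /mu /= /mscale/= => ->.
by rewrite muleA -EFinM mulVf ?mul1e// gt_eqF.
Qed.

Definition rV_dilation n (c : 'I_n -> R) (x : 'rV[R]_n) : 'rV[R]_n :=
  \row_i (c i * x ord0 i)%R.

Lemma measurable_rV_dilation n (c : 'I_n -> R) :
  measurable_fun setT (rV_dilation c).
Proof.
apply: measurable_fun_rVP => i.
rewrite [X in measurable_fun _ X](_ : _ = fun x => c i * rV_coord i x)%R.
  by apply: measurable_funM => //; exact: measurable_rV_coord.
by apply/funext => x; rewrite /rV_coord/= mxE.
Qed.

(** Induction on the dimension: Tonelli splits off the first coordinate, which is rescaled by the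
    one-dimensional case. *)
Lemma ge0_integral_rV_dilation n (c : 'I_n -> R) (f : 'rV[R]_n -> \bar R) :
    (forall i, 0 < c i)%R -> measurable_fun setT f -> (forall x, 0 <= f x) ->
  \int[lebesgue_rV n]_x f (rV_dilation c x) =
  (\prod_(i < n) (c i)^-1)%:E * \int[lebesgue_rV n]_x f x.
Proof.
elim: n c f => [|n IHn] c f c0 mf f0.
  rewrite big_ord0 mul1e; apply: eq_integral => x _; congr f.
  by apply/rowP => -[].
rewrite !ge0_integral_rV_cons//; last first.
  by apply: measurableT_comp => //; exact: measurable_rV_dilation.
pose c' i := c (lift ord0 i).
have consE a x : rV_dilation c (rV_cons (a, x)) =
    rV_cons ((c ord0 * a)%R, rV_dilation c' x).
  apply/rowP => i; rewrite !mxE.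
  by case: (unliftP ord0 i) => [j|] -> /=; rewrite ?mxE.
have mcons a : measurable_fun setT (fun x => f (rV_cons (a, x))).
  apply: (measurableT_comp mf (g := fun x => rV_cons (a, x))).
  apply: (measurableT_comp (@measurable_rV_cons R n) (g := fun x => (a, x))).
  exact: measurable_fun_pair.
have c'0 : (0 <= \prod_(i < n) (c' i)^-1)%R.
  by apply: prodr_ge0 => i _; rewrite invr_ge0; exact/ltW/c0.
have mI := measurable_fun_integral_rV_cons mf f0.
pose g a := \int[lebesgue_rV n]_x f (rV_cons (a, x)).
transitivity (\int[lebesgue_measure]_a
    ((\prod_(i < n) (c' i)^-1)%:E * g (c ord0 * a)%R)).
  apply: eq_integral => a _; rewrite /g.
  rewrite -(IHn c' (fun x => f (rV_cons (_, x))) (fun i => c0 (lift ord0 i)))//.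
  by apply: eq_integral => x _; rewrite consE.
transitivity ((\prod_(i < n) (c' i)^-1)%:E *
    \int[lebesgue_measure]_a g (c ord0 * a)%R).
  apply: ge0_integralZl => //.
    by apply: (measurableT_comp mI); exact: measurable_funM.
  by move=> a _; apply: integral_ge0.
rewrite (ge0_integral_dilation1 (c0 ord0) mI); last first.
  by move=> a; apply: integral_ge0.
by rewrite muleA -EFinM big_ord_recl mulrC.
Qed.

(** [b] is the lowest corner, not the centre, so cubes of positive side with a common [b] are
    nested. *)
Definition rV_cube n (b : 'rV[R]_n) (r : R) : set 'rV[R]_n :=
  [set x | forall i, `[b ord0 i, (b ord0 i + r)%R]%classic (x ord0 i)].

Lemma measurable_rV_cube n (b : 'rV[R]_n) r : measurable (rV_cube b r).
Proof.
exact: (@measurable_rV_box R n (fun i => `[b ord0 i, (b ord0 i + r)%R]%classic)).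
Qed.

Lemma lebesgue_rV_cube n (b : 'rV[R]_n) r : (0 < r)%R ->
  lebesgue_rV n (rV_cube b r) = (r ^+ n)%:E.
Proof.
move=> r0.
rewrite (@lebesgue_rV_box R n (fun i => `[b ord0 i, (b ord0 i + r)%R]%classic))//.
under eq_bigr => i _.
  rewrite lebesgue_measure_itv/= lte_fin ltrDl r0 -EFinB addrAC subrr add0r.
  over.
by rewrite prodEFin prodr_const card_ord.
Qed.

(** It makes the singular set of the weight negligible: for [0 < k], [head_norm k x = 0] forces the
    first coordinate to vanish. *)
Lemma lebesgue_rV_hyperplane n (i : 'I_n) :
  lebesgue_rV n [set x : 'rV[R]_n | x ord0 i = 0%R] = 0.
Proof.
pose A (j : 'I_n) : set (measurableTypeR R) := if j == i then [set 0%R] else setT.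
have mA j : measurable (A j).
  by rewrite /A; case: ifP => _ //; exact: measurable_set1.
have -> : [set x : 'rV[R]_n | x ord0 i = 0%R] =
    [set x | forall j, A j (x ord0 j)].
  apply/seteqP; split => [x/= x0 j|x /(_ i)]; rewrite /A ?eqxx//.
  by case: eqP => // ->.
rewrite lebesgue_rV_box// (bigD1 i)//= /A eqxx.
by rewrite [X in X * _](_ : _ = 0) ?mul0e//; exact: lebesgue_measure_set1.
Qed.

End rV_measure_theory.

(** * Cubes and the norm of the first coordinates *)

Section head_norm_theory.
Context {R : realType} {d : nat}.
Implicit Types (k : nat) (x y b : 'rV[R]_d) (r c : R).

Lemma sum_head_sqr_ge0 k x : 0 <= \sum_(i < d | (i < k)%N) x ord0 i ^+ 2.
Proof. by apply: sumr_ge0 => i _; exact: sqr_ge0. Qed.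

Lemma sqr_head_norm k x :
  head_norm k x ^+ 2 = \sum_(i < d | (i < k)%N) x ord0 i ^+ 2.
Proof. by rewrite sqr_sqrtr// sum_head_sqr_ge0. Qed.

Lemma head_norm_ge0 k x : 0 <= head_norm k x.
Proof. exact: sqrtr_ge0. Qed.

Lemma enormE x : enorm x = head_norm d x.
Proof. by congr Num.sqrt; apply: eq_bigl => i; rewrite ltn_ord. Qed.

Lemma normr_le_head_norm k x (i : 'I_d) :
  (i < k)%N -> `|x ord0 i| <= head_norm k x.
Proof.
move=> ik; rewrite -sqrtr_sqr; apply: ler_wsqrtr.
by rewrite (bigD1 i)//= lerDl; apply: sumr_ge0 => j _; exact: sqr_ge0.
Qed.

Lemma enorm_le x c :
  (forall i, `|x ord0 i| <= c) -> 0 <= c -> enorm x <= d%:R * c.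
Proof.
move=> xc c0; rewrite /enorm -[leRHS]ger0_norm ?mulr_ge0// -sqrtr_sqr.
apply: ler_wsqrtr; apply: (@le_trans _ _ (\sum_(i < d) c ^+ 2)).
  apply: ler_sum => i _.
  by rewrite -[x ord0 i ^+ 2]ger0_norm ?sqr_ge0// normrX lerXn2r.
rewrite sumr_const card_ord -[leLHS]mulr_natl exprMn ler_wpM2r ?sqr_ge0//.
rewrite -natrX ler_nat; case: (d) => // n; exact: leq_pmulr.
Qed.

Lemma sum_head_cst_le k c : 0 <= c -> \sum_(i < d | (i < k)%N) c <= d%:R * c.
Proof.
move=> c0; rewrite -[d in leRHS]card_ord mulr_natl -sumr_const.
by rewrite [leLHS]big_mkcond; apply: ler_sum => i _; case: ifP.
Qed.

Lemma sqr_head_norm_le k x b r :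
  0 <= r -> (forall i, `|x ord0 i - b ord0 i| <= r) ->
  head_norm k x ^+ 2 <= 2 * head_norm k b ^+ 2 + 2 * (d%:R * r ^+ 2).
Proof.
move=> r0 xb; rewrite !sqr_head_norm.
apply: (@le_trans _ _ (\sum_(i < d | (i < k)%N) (2 * b ord0 i ^+ 2 + 2 * r ^+ 2))).
  apply: ler_sum => i _.
  have : (x ord0 i - b ord0 i) ^+ 2 <= r ^+ 2.
    by rewrite -[leLHS]ger0_norm ?sqr_ge0// normrX lerXn2r.
  (* This rests on [x^2 + (2b - x)^2 = 2 b^2 + 2 (x - b)^2]. *)
  by have := sqr_ge0 (2 * b ord0 i - x ord0 i); nra.
rewrite big_split/= -mulr_sumr lerD2l -mulr_sumr.
by rewrite ler_wpM2l// sum_head_cst_le ?sqr_ge0.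
Qed.

(** The side condition gives [d r^2 <= |b_k|^2 / 4]; the quadratic bound above, used from [b] to [x]
    and back, then gives both comparisons. *)
Lemma head_norm_cube k b r x : (0 < d)%N -> 0 <= r ->
  r <= head_norm k b / (2 * d%:R) -> rV_cube b r x ->
  head_norm k b / 2 <= head_norm k x <= 2 * head_norm k b.
Proof.
move=> d0 r0 rb xQ.
have xb i : `|x ord0 i - b ord0 i| <= r.
  have := xQ i; rewrite /= in_itv/= ler_distl => /andP[? ?].
  by apply/andP; split; lra.
have bx i : `|b ord0 i - x ord0 i| <= r by rewrite distrC.
have H1 := sqr_head_norm_le k r0 xb.
have H2 := sqr_head_norm_le k r0 bx.
have X0 := head_norm_ge0 k x; have B0 := head_norm_ge0 k b.
have dr : d%:R * r ^+ 2 <= head_norm k b ^+ 2 / 4.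
  have d1 : 1 <= d%:R :> R by rewrite ler1n.
  have : d%:R * r <= head_norm k b / 2.
    move: rb; rewrite ler_pdivlMr ?mulr_gt0 ?ltr0n// => rb.
    by rewrite ler_pdivlMr//; lra.
  have : r <= d%:R * r by rewrite ler_peMl.
  by rewrite expr2 mulrA; nra.
apply/andP; split; rewrite -(@ler_pXn2r _ 2) ?nnegrE ?mulr_ge0 ?divr_ge0//; nra.
Qed.

Lemma measurable_head_norm k :
  measurable_fun setT (head_norm k : 'rV[R]_d -> R).
Proof.
rewrite [X in measurable_fun _ X](_ : _ = (@powR R ^~ 2^-1) \o
    fun x => \sum_(i < d) (if (i < k)%N then x ord0 i ^+ 2 else 0)).
  apply: measurableT_comp; first exact: (@measurable_powR R (2^-1)).
  apply: measurable_sum => i; case: (i < k)%N => //.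
  by apply: measurable_funX; exact: measurable_rV_coord.
apply/funext => x /=; rewrite powR12_sqrt.
  by congr Num.sqrt; exact: big_mkcond.
by apply: sumr_ge0 => i _; case: ifP => // _; exact: sqr_ge0.
Qed.

(** This is the map D of the overview. It doubles [head_norm k] and has Jacobian [2^k], which is why
    [gamma] is compared with [k]. *)
Definition head_dilation k : 'rV[R]_d -> 'rV[R]_d :=
  rV_dilation (fun i : 'I_d => if (i < k)%N then 2 else 1).

Lemma head_norm_dilation k x :
  head_norm k (head_dilation k x) = 2 * head_norm k x.
Proof.
rewrite /head_norm -[2 in RHS]ger0_norm// -sqrtr_sqr -sqrtrM ?sqr_ge0//.
congr Num.sqrt; rewrite mulr_sumr; apply: eq_bigr => i ik.
by rewrite mxE ik exprMn.
Qed.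

Lemma measurable_head_dilation k : measurable_fun setT (head_dilation k).
Proof. exact: measurable_rV_dilation. Qed.

Lemma ge0_integral_head_dilation k (f : 'rV[R]_d -> \bar R) : (k <= d)%N ->
    measurable_fun setT f -> (forall x, 0 <= f x)%E ->
  (\int[lebesgue_rV d]_x f (head_dilation k x) =
   (2^-1 ^+ k)%:E * \int[lebesgue_rV d]_x f x)%E.
Proof.
move=> kd mf f0; rewrite ge0_integral_rV_dilation//; last by move=> i; case: ifP.
congr (_%:E * _)%E.
rewrite (eq_bigr (fun i : 'I_d => if (i < k)%N then 2^-1 else 1)); last first.
  by move=> i _; case: ifP => // _; rewrite invr1.
rewrite -big_mkcond/= -(big_ord_widen _ (fun=> 2^-1))//.
by rewrite prodr_const card_ord.
Qed.

Lemma dist_dilation_cube k y x r : (0 < d)%N -> 0 <= r ->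
  r <= head_norm k y / d%:R -> rV_cube (head_dilation k y) r x ->
  forall i, `|x ord0 i - y ord0 i| <= 2 * head_norm k y.
Proof.
move=> d0 r0 ry xQ i.
have r1 : r <= head_norm k y.
  rewrite (le_trans ry)// ler_pdivrMr ?ltr0n// ler_peMr ?head_norm_ge0//.
  by rewrite ler1n.
have := xQ i; rewrite /= in_itv/= mxE; case: ifPn => [ik|_] /andP[h1 h2].
  have := normr_le_head_norm y ik; rewrite ler_norml => /andP[? ?].
  by rewrite ler_norml; apply/andP; split; lra.
by rewrite ler_norml; apply/andP; split; lra.
Qed.

End head_norm_theory.

(** * Averages over cubes *)

Section cube_averages.
Context {R : realType} {d : nat}.
Variable u : 'rV[R]_d -> R.

Definition cube_average (b : 'rV[R]_d) (r : R) : R :=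
  (\int[lebesgue_rV d]_(x in rV_cube b r) u x) / r ^+ d.

Variable N : R.
Hypothesis mu : measurable_fun setT u.
Hypothesis uN : forall x, `|u x| <= N.
Implicit Types (b : 'rV[R]_d) (r c t p M : R).

(** The constant [c] is its own average, so the difference is the average of [u - c]; boundedness of
    [u] supplies integrability. *)
Lemma cube_average_dist b r c : 0 < r ->
  ((`|cube_average b r - c|)%:E <=
   ((r ^+ d)^-1)%:E *
   \int[lebesgue_rV d]_(x in rV_cube b r) (`|u x - c|)%:E)%E.
Proof.
move=> r0; have v0 : 0 < r ^+ d by exact: exprn_gt0.
have mQ : measurable (rV_cube b r) by exact: measurable_rV_cube.
have finQ : (lebesgue_rV d (rV_cube b r) < +oo)%E.
  by rewrite lebesgue_rV_cube// ltry.
have intu : (lebesgue_rV d).-integrable (rV_cube b r) (EFin \o u).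
  apply: measurable_bounded_integrable => //; first exact: measurable_funTS.
  exists N; split; [exact: num_real|].
  by move=> y Ny x _; exact: le_trans (uN x) (ltW Ny).
have intc : (lebesgue_rV d).-integrable (rV_cube b r) (EFin \o cst c).
  apply: measurable_bounded_integrable => //.
  exists `|c|; split; [exact: num_real|].
  by move=> y cy x _; exact: ltW.
have intuc : (lebesgue_rV d).-integrable (rV_cube b r)
    (EFin \o (fun x => u x - c)).
  rewrite [X in _.-integrable _ X](_ : _ = (EFin \o u) \- (EFin \o cst c))%E//.
  exact: integrableB.
have -> : cube_average b r - c =
    (r ^+ d)^-1 * \int[lebesgue_rV d]_(x in rV_cube b r) (u x - c).
  rewrite (RintegralB _ _ intc)// Rintegral_cst//.
  rewrite [fine _](congr1 fine (lebesgue_rV_cube b r0))/=.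
  by rewrite mulrBr [c * _]mulrC mulKf ?gt_eqF// mulrC.
rewrite normrM (@ger0_norm _ (_ ^-1)) ?invr_ge0 ?(ltW v0)// EFinM.
rewrite lee_pmul2l ?lte_fin ?invr_gt0//.
rewrite EFin_normr_Rintegral//.
by apply: le_abse_integral => //; case/integrableP : intuc.
Qed.

(** Averages a bound of the form produced by [ler_addl_powR], so that the substitute for Jensen's
    inequality serves for single and double averages. *)
Lemma cube_integral_affine b r t c (f : 'rV[R]_d -> R) (G : 'rV[R]_d -> \bar R) :
    0 < r -> 0 <= t -> 0 <= c ->
    measurable_fun setT f -> (forall x, 0 <= f x) ->
    measurable_fun setT G -> (forall x, 0 <= G x)%E ->
    (forall x, rV_cube b r x -> (f x)%:E <= t%:E + c%:E * G x)%E ->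
  (((r ^+ d)^-1)%:E * \int[lebesgue_rV d]_(x in rV_cube b r) (f x)%:E <=
   t%:E + (c / r ^+ d)%:E * \int[lebesgue_rV d]_(x in rV_cube b r) G x)%E.
Proof.
move=> r0 t0 c0 mf f0 mG G0 fG; have v0 : 0 < r ^+ d by exact: exprn_gt0.
have mQ : measurable (rV_cube b r) by exact: measurable_rV_cube.
have mGQ : measurable_fun (rV_cube b r) G by exact: measurable_funTS.
apply: (@le_trans _ _ (((r ^+ d)^-1)%:E *
  \int[lebesgue_rV d]_(x in rV_cube b r) (t%:E + c%:E * G x)))%E.
  rewrite lee_pmul2l ?lte_fin ?invr_gt0//; apply: ge0_le_integral => //.
  - by move=> x _; rewrite lee_fin.
  - by apply/measurable_EFinP; exact: measurable_funTS.
  - by apply: emeasurable_funD => //; exact: measurable_funeM.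
rewrite ge0_integralD//; last 2 first.
- by move=> x _; rewrite mule_ge0 ?lee_fin.
- exact: measurable_funeM.
rewrite integral_cst// ge0_integralZl//.
rewrite [X in (_ * (_ * X + _))%E](lebesgue_rV_cube b r0).
rewrite muleDr ?ge0_adde_def ?inE ?mule_ge0 ?lee_fin ?integral_ge0 ?(ltW v0)//.
rewrite (_ : (r ^- d)%:E * (t%:E * (r ^+ d)%:E) = t%:E)%E; last first.
  by rewrite -!EFinM mulrCA mulVf ?mulr1// gt_eqF.
by rewrite muleA -EFinM mulrC.
Qed.

Lemma measurable_powR_dist c p :
  measurable_fun setT (fun x => (`|u x - c| `^ p)%:E).
Proof.
apply/measurable_EFinP.
rewrite [X in measurable_fun _ X](_ : _ = (@powR R ^~ p) \o fun x => `|u x - c|)//.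
apply: measurableT_comp; first exact: measurable_powR.
by apply: measurableT_comp => //; exact: measurable_funB.
Qed.

Lemma cube_average_dist_powR b r c t p : 1 <= p -> 0 < r -> 0 < t ->
  ((`|cube_average b r - c|)%:E <= t%:E + (t `^ (1 - p) / r ^+ d)%:E *
     \int[lebesgue_rV d]_(x in rV_cube b r) (`|u x - c| `^ p)%:E)%E.
Proof.
move=> p1 r0 t0; apply: (le_trans (cube_average_dist b c r0)).
apply: cube_integral_affine => //; first exact: ltW.
- exact: powR_ge0.
- by apply: measurableT_comp => //; exact: measurable_funB.
- exact: measurable_powR_dist.
- by move=> x _; rewrite -EFinM -EFinD lee_fin ler_addl_powR.
Qed.

(** The choice [t = M] gives [M + M^(1-p) M^p = 2 M]; for [M = 0], let [t] tend to 0. *)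
Lemma ler_double_powR p M (a : R) : 1 <= p -> 0 <= M ->
  (forall t, 0 < t -> a <= t + t `^ (1 - p) * M `^ p) -> a <= 2 * M.
Proof.
move=> p1; rewrite le_eqVlt => /predU1P[<-|M0] aM.
  rewrite mulr0; apply/ler_addgt0Pl => t t0; rewrite addr0.
  by have := aM t t0; rewrite powR0 ?mulr0 ?addr0// gt_eqF// (lt_le_trans ltr01).
have := aM M M0; rewrite -powRD ?subrK ?gt_eqF ?implybT//.
by rewrite powRr1 ?(ltW M0)//; lra.
Qed.

Lemma cube_average_near_value b r c p M : 1 <= p -> 0 < r -> 0 <= M ->
  (\int[lebesgue_rV d]_(x in rV_cube b r) (`|u x - c| `^ p)%:E <=
   (r ^+ d * M `^ p)%:E)%E ->
  `|cube_average b r - c| <= 2 * M.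
Proof.
move=> p1 r0 M0 H; have v0 : 0 < r ^+ d by exact: exprn_gt0.
apply: (ler_double_powR p1) => // t t0; rewrite -lee_fin.
apply: (le_trans (cube_average_dist_powR b c p1 r0 t0)).
rewrite EFinD leeD2l// (_ : (t `^ (1 - p) * M `^ p)%:E =
  (t `^ (1 - p) / r ^+ d)%:E * (r ^+ d * M `^ p)%:E)%E.
  by rewrite lee_wpmul2l// lee_fin divr_ge0 ?powR_ge0// ltW.
by rewrite -EFinM mulrA divfK// gt_eqF.
Qed.

(** The parameter [t] is chosen once, after averaging over both cubes, so the loss is a single
    factor 2. The majorant [G] stands for the inner integral and carries the measurability. *)
Lemma cube_average_near_average b r b' r' p M (G : 'rV[R]_d -> \bar R) :
    1 <= p -> 0 < r -> 0 < r' -> 0 <= M ->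
    measurable_fun setT G -> (forall x, 0 <= G x)%E ->
    (forall y, rV_cube b' r' y ->
      \int[lebesgue_rV d]_(x in rV_cube b r) (`|u x - u y| `^ p)%:E <= G y)%E ->
    (\int[lebesgue_rV d]_y G y <= (r ^+ d * r' ^+ d * M `^ p)%:E)%E ->
  `|cube_average b r - cube_average b' r'| <= 2 * M.
Proof.
move=> p1 r0 r'0 M0 mG G0 uG GM.
have v0 : 0 < r ^+ d by exact: exprn_gt0.
have v'0 : 0 < r' ^+ d by exact: exprn_gt0.
apply: (ler_double_powR p1) => // t t0; rewrite -lee_fin distrC.
apply: (le_trans (cube_average_dist b' (cube_average b r) r'0)).
have c0 : 0 <= t `^ (1 - p) / r ^+ d by rewrite divr_ge0 ?powR_ge0// ltW.
apply: (@le_trans _ _ (t%:E + (t `^ (1 - p) / r ^+ d / r' ^+ d)%:E *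
    \int[lebesgue_rV d]_(y in rV_cube b' r') G y)%E).
  apply: cube_integral_affine => //; first exact: ltW.
    by apply: measurableT_comp => //; exact: measurable_funB.
  move=> y Qy; rewrite distrC.
  apply: (le_trans (cube_average_dist_powR b (u y) p1 r0 t0)).
  by rewrite leeD2l// lee_wpmul2l ?lee_fin//; exact: uG.
rewrite EFinD leeD2l// (_ : (t `^ (1 - p) * M `^ p)%:E =
  (t `^ (1 - p) / r ^+ d / r' ^+ d)%:E * (r ^+ d * r' ^+ d * M `^ p)%:E)%E.
  rewrite lee_wpmul2l ?lee_fin ?divr_ge0// ?(ltW v'0) ?powR_ge0 ?(ltW v0)//.
  apply: le_trans GM; apply: ge0_subset_integral => //.
  exact: measurable_rV_cube.
rewrite -EFinM; congr EFin; field.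
by rewrite !gt_eqF.
Qed.

End cube_averages.

(** * Oscillation bounds *)

Section weighted_gagliardo_theory.
Context {R : realType} {d k : nat}.
Variables (s p cw : R) (w : 'rV[R]_d -> 'rV[R]_d -> R).
Hypotheses (d0 : (0 < d)%N) (s0 : 0 < s) (p1 : 1 <= p) (cw0 : 0 < cw).
Hypothesis w0 : forall x y, 0 <= w x y.
Hypothesis mw :
  measurable_fun setT (fun z : 'rV[R]_d * 'rV[R]_d => w z.1 z.2).
Hypothesis w_ge : forall (h : R) x y, 0 < h ->
  h / 4 <= head_norm k x <= 4 * h -> h / 4 <= head_norm k y <= 4 * h ->
  cw * h `^ (s * p - k%:R) <= w x y.

Definition gagliardo_kernel (u : 'rV[R]_d -> R) x y : R :=
  `|u x - u y| `^ p / enorm (x - y) `^ (d%:R + s * p) * w x y.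

(** The inner integral F of the overview, in the order of integration of [weighted_gagliardo]. *)
Definition gagliardo_slice u y : \bar R :=
  (\int[lebesgue_rV d]_x (gagliardo_kernel u x y)%:E)%E.

Variables (u : 'rV[R]_d -> R) (N : R).
Hypothesis mu : measurable_fun setT u.
Hypothesis uN : forall x, `|u x| <= N.

Local Notation K := (gagliardo_kernel u).
Local Notation F := (gagliardo_slice u).

Lemma gagliardo_kernel_ge0 x y : 0 <= K x y.
Proof. by rewrite mulr_ge0// divr_ge0// powR_ge0. Qed.

Lemma measurable_gagliardo_kernel :
  measurable_fun setT (fun z : 'rV[R]_d * 'rV[R]_d => (K z.1 z.2)%:E).
Proof.
apply/measurable_EFinP; apply: measurable_funM => //.
apply: measurable_funM.
  rewrite [X in measurable_fun _ X](_ : _ = (@powR R ^~ p) \o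
    (fun z : 'rV[R]_d * 'rV[R]_d => `|u z.1 - u z.2|))//.
  apply: measurableT_comp; first exact: measurable_powR.
  apply: measurableT_comp => //; apply: measurable_funB.
  - by apply: (measurableT_comp mu); exact: measurable_fst.
  - by apply: (measurableT_comp mu); exact: measurable_snd.
rewrite [X in measurable_fun _ X](_ : _ =
  (@powR R ^~ (- (d%:R + s * p))) \o (head_norm d) \o
  (fun z : 'rV[R]_d * 'rV[R]_d => z.1 - z.2)); last first.
  by apply/funext => z /=; rewrite powRN enormE.
apply: measurableT_comp.
  by apply: measurableT_comp; [exact: measurable_powR|exact: measurable_head_norm].
apply: measurable_fun_rVP => i.
rewrite [X in measurable_fun _ X](_ : _ =
    fun z : 'rV[R]_d * 'rV[R]_d => rV_coord i z.1 - rV_coord i z.2); last first.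
  by apply/funext => z; rewrite /rV_coord/= !mxE.
apply: measurable_funB.
- by apply: (measurableT_comp (measurable_rV_coord i)); exact: measurable_fst.
- by apply: (measurableT_comp (measurable_rV_coord i)); exact: measurable_snd.
Qed.

Lemma measurable_gagliardo_slice : measurable_fun setT F.
Proof.
exact: (@measurable_fun_fubini_tonelli_G _ _ _ _ _ (lebesgue_rV d)
  _ measurable_gagliardo_kernel (fun z => gagliardo_kernel_ge0 z.1 z.2)).
Qed.

Lemma gagliardo_slice_ge0 y : (0 <= F y)%E.
Proof. by apply: integral_ge0 => x _; rewrite lee_fin gagliardo_kernel_ge0. Qed.

Lemma measurable_gagliardo_kernel_l y :
  measurable_fun setT (fun x => (K x y)%:E).
Proof.
rewrite [X in measurable_fun _ X](_ : _ =
  (fun z : 'rV[R]_d * 'rV[R]_d => (K z.1 z.2)%:E) \o (fun x => (x, y)))//.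
apply: measurableT_comp; first exact: measurable_gagliardo_kernel.
exact: measurable_fun_pair.
Qed.

(** For [h > 0] this is [(d l h)^(d+sp) / (cw h^(sp-k))]: the bound on the kernel's denominator at
    distances up to [d l h], divided by the lower bound on the weight. *)
Definition oscillation_factor (l h : R) : R :=
  (d%:R * l) `^ (d%:R + s * p) / cw * h ^+ (d + k).

Lemma powR_dist_le_kernel (h l : R) x y : 0 < h -> 0 < l ->
  h / 4 <= head_norm k x <= 4 * h -> h / 4 <= head_norm k y <= 4 * h ->
  (forall i, `|x ord0 i - y ord0 i| <= l * h) ->
  `|u x - u y| `^ p <= oscillation_factor l h * K x y.
Proof.
(* The case of equal values includes [x = y], where the kernel's denominator vanishes. *)
move=> h0 l0 xh yh xy; have [uxy|uxy] := eqVneq (u x) (u y).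
  rewrite uxy subrr normr0 powR0; last by rewrite gt_eqF// (lt_le_trans ltr01).
  rewrite mulr_ge0 ?gagliardo_kernel_ge0// mulr_ge0 ?exprn_ge0 ?(ltW h0)//.
  by rewrite divr_ge0 ?powR_ge0// ltW.
have dl0 : 0 < d%:R * l by rewrite mulr_gt0// ltr0n.
have E_le : enorm (x - y) <= d%:R * l * h.
  rewrite -mulrA; apply: enorm_le; last by rewrite mulr_ge0 ?ltW.
  by move=> i; rewrite !mxE.
have E_gt0 : 0 < enorm (x - y).
  rewrite lt_neqAle sqrtr_ge0 andbT; apply: contra uxy => /eqP E0.
  suff -> : x = y by [].
  apply/rowP => i; apply/eqP; rewrite -subr_eq0 -normr_le0.
  have := @normr_le_head_norm _ d d (x - y) i (ltn_ord i).
  by rewrite -enormE -E0 !mxE.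
set A := `|u x - u y| `^ p; have A0 : 0 <= A by exact: powR_ge0.
have Np : 0 <= d%:R + s * p by rewrite addr_ge0// mulr_ge0 ?ltW// (lt_le_trans ltr01).
have EN : enorm (x - y) `^ (d%:R + s * p) <=
    (d%:R * l) `^ (d%:R + s * p) * h `^ (d%:R + s * p).
  by rewrite -powRM ?(ltW dl0) ?(ltW h0)// le_powR// ltW.
have hN : h ^+ (d + k) * h `^ (s * p - k%:R) = h `^ (d%:R + s * p).
  rewrite -powR_mulrn ?(ltW h0)// -powRD ?(gt_eqF h0) ?implybT//; congr (_ `^ _).
  by rewrite natrD; ring.
rewrite /K -/A /oscillation_factor.
have E0 : 0 < enorm (x - y) `^ (d%:R + s * p) by rewrite powR_gt0.
rewrite (_ : _ * _ = A * ((d%:R * l) `^ (d%:R + s * p) / cw * h ^+ (d + k) *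
  (w x y / enorm (x - y) `^ (d%:R + s * p)))); last by ring.
rewrite -[leLHS]mulr1 ler_wpM2l// mulrA ler_pdivlMr// mul1r.
rewrite (le_trans EN)// -hN -!mulrA ler_wpM2l ?powR_ge0//.
rewrite ler_pdivlMl// mulrCA ler_wpM2l ?exprn_ge0 ?(ltW h0)//.
exact: w_ge.
Qed.

Lemma cube_oscillation_le_slice (h l r : R) b y : 0 < h -> 0 < l ->
  h / 4 <= head_norm k y <= 4 * h ->
  (forall x, rV_cube b r x -> h / 4 <= head_norm k x <= 4 * h /\
     forall i, `|x ord0 i - y ord0 i| <= l * h) ->
  (\int[lebesgue_rV d]_(x in rV_cube b r) (`|u x - u y| `^ p)%:E <=
   (oscillation_factor l h)%:E * F y)%E.
Proof.
move=> h0 l0 yh Qh; have mQ := measurable_rV_cube b r.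
have L0 : 0 <= oscillation_factor l h.
  by rewrite mulr_ge0 ?exprn_ge0 ?(ltW h0)// divr_ge0 ?powR_ge0// ltW.
have mK := measurable_gagliardo_kernel_l y.
have K0 x : (0 <= (K x y)%:E)%E by rewrite lee_fin gagliardo_kernel_ge0.
rewrite -ge0_integralZl//.
apply: (@le_trans _ _ (\int[lebesgue_rV d]_(x in rV_cube b r)
    ((oscillation_factor l h)%:E * (K x y)%:E))%E).
  apply: ge0_le_integral => //.
  - by apply: measurable_funTS; exact: (measurable_powR_dist mu).
  - by apply: measurable_funTS; exact: measurable_funeM.
  move=> x Qx; rewrite -EFinM lee_fin; have [xh xy] := Qh _ Qx.
  exact: powR_dist_le_kernel.
apply: ge0_subset_integral => //; first exact: measurable_funeM.
by move=> x _; rewrite mule_ge0.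
Qed.

(** Since [Y^p = h^k F(y)], the factor [h^(d+k)] of the oscillation bound cancels against [Y^p] and
    the volume of the cube. What remains is a numerical inequality between [l], [a] and [M]. *)
Lemma cube_average_value_slice (h l a M Y f : R) b y :
  0 < h -> 0 < l -> 0 < a -> 0 <= M -> 0 <= Y ->
  h / 4 <= head_norm k y <= 4 * h ->
  (forall x, rV_cube b (a * h) x -> h / 4 <= head_norm k x <= 4 * h /\
     forall i, `|x ord0 i - y ord0 i| <= l * h) ->
  F y = f%:E -> Y `^ p = h ^+ k * f ->
  (d%:R * l) `^ (d%:R + s * p) / cw <= a ^+ d * M `^ p ->
  `|u y - cube_average u b (a * h)| <= 2 * M * Y.
Proof.
move=> h0 l0 a0 M0 Y0 yh Qh Ff Yp LM; rewrite distrC -mulrA.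
have f0 : 0 <= f by rewrite -lee_fin -Ff gagliardo_slice_ge0.
apply: (cube_average_near_value mu uN p1); [exact: mulr_gt0|exact: mulr_ge0|].
apply: (le_trans (cube_oscillation_le_slice h0 l0 yh Qh)).
rewrite Ff -EFinM lee_fin powRM// Yp /oscillation_factor exprMn exprD.
rewrite [leRHS](_ : _ = a ^+ d * M `^ p * (h ^+ d * h ^+ k * f)); last by ring.
rewrite [leLHS](_ : _ = (d%:R * l) `^ (d%:R + s * p) / cw *
  (h ^+ d * h ^+ k * f)); last by ring.
by rewrite ler_wpM2r ?mulr_ge0// ?exprn_ge0 ?(ltW h0)//.
Qed.

(** The same cancellation with the whole energy in place of a slice and with two volumes:
    [X^p = h^(k-d) e] absorbs the powers of [h]. *)
Lemma cube_average_average_energy (h l a a' M X e : R) b b' :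
  0 < h -> 0 < l -> 0 < a -> 0 < a' -> 0 <= M -> 0 <= X ->
  (forall x, rV_cube b (a * h) x -> h / 4 <= head_norm k x <= 4 * h) ->
  (forall x, rV_cube b' (a' * h) x -> h / 4 <= head_norm k x <= 4 * h) ->
  (forall x y, rV_cube b (a * h) x -> rV_cube b' (a' * h) y ->
     forall i, `|x ord0 i - y ord0 i| <= l * h) ->
  0 <= e -> (\int[lebesgue_rV d]_y F y <= e%:E)%E ->
  X `^ p * h ^+ d = h ^+ k * e ->
  (d%:R * l) `^ (d%:R + s * p) / cw <= a ^+ d * a' ^+ d * M `^ p ->
  `|cube_average u b (a * h) - cube_average u b' (a' * h)| <= 2 * M * X.
Proof.
move=> h0 l0 a0 a'0 M0 X0 Qh Q'h QQ' e0 Fe Xp LM; rewrite -mulrA.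
have L0 : 0 <= oscillation_factor l h.
  by rewrite mulr_ge0 ?exprn_ge0 ?(ltW h0)// divr_ge0 ?powR_ge0// ltW.
have mF := measurable_gagliardo_slice.
have F0 := gagliardo_slice_ge0.
apply: (@cube_average_near_average _ _ _ _ mu uN _ _ _ _ _ _
    (fun y => (oscillation_factor l h)%:E * F y)%E p1) => //.
- exact: mulr_gt0.
- exact: mulr_gt0.
- exact: mulr_ge0.
- exact: measurable_funeM.
- by move=> x; rewrite mule_ge0// lee_fin.
- move=> y Q'y; apply: (cube_oscillation_le_slice h0 l0 (Q'h _ Q'y)) => x Qx.
  by split; [exact: Qh|exact: QQ'].
rewrite ge0_integralZl//.
apply: (@le_trans _ _ ((oscillation_factor l h)%:E * e%:E)%E).
  by rewrite lee_wpmul2l ?lee_fin.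
rewrite -EFinM lee_fin powRM// /oscillation_factor !exprMn exprD.
rewrite [leRHS](_ : _ = a ^+ d * a' ^+ d * M `^ p * (h ^+ d * (X `^ p * h ^+ d)));
  last by ring.
rewrite Xp [leLHS](_ : _ = (d%:R * l) `^ (d%:R + s * p) / cw *
  (h ^+ d * (h ^+ k * e))); last by ring.
by rewrite ler_wpM2r ?mulr_ge0// ?exprn_ge0 ?(ltW h0).
Qed.

End weighted_gagliardo_theory.

(** * Hedberg optimization at a point *)

Section pointwise.
Context {R : realType} {d k : nat}.
Variables (s p q cw : R) (w : 'rV[R]_d -> 'rV[R]_d -> R).
Hypotheses (d0 : (0 < d)%N) (s0 : 0 < s) (p1 : 1 <= p) (cw0 : 0 < cw).
Hypotheses (pq : p < q) (sobolev : d%:R / p - s <= d%:R / q).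
Hypothesis w0 : forall x y, 0 <= w x y.
Hypothesis mw :
  measurable_fun setT (fun z : 'rV[R]_d * 'rV[R]_d => w z.1 z.2).
Hypothesis w_ge : forall (h : R) x y, 0 < h ->
  h / 4 <= head_norm k x <= 4 * h -> h / 4 <= head_norm k y <= 4 * h ->
  cw * h `^ (s * p - k%:R) <= w x y.

Local Notation F := (gagliardo_slice s p w).
Local Notation gamma := (d%:R + (k%:R - d%:R) * (q / p)).
(* On a cube of side at most [c0 |y_k|] with corner [y], the norm of the first
   [k] coordinates stays between [|y_k| / 2] and [2 |y_k|]. *)
Let c0 : R := (2 * d%:R)^-1.

Let p0 : 0 < p. Proof. exact: lt_le_trans p1. Qed.
Let q0 : 0 < q. Proof. exact: lt_trans pq. Qed.
Let dR0 : 0 < d%:R :> R. Proof. by rewrite ltr0n. Qed.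
Let c00 : 0 < c0. Proof. by rewrite invr_gt0 mulr_gt0. Qed.

Lemma exprn_powR2 (a : R) m : (2 `^ a) ^+ m = 2 `^ (a * m%:R) :> R.
Proof. by rewrite -powR_mulrn ?powR_ge0// powRrM. Qed.

Lemma expr2V_powR m : (2^-1) ^+ m = 2 `^ (- m%:R) :> R.
Proof. by rewrite powR_invn// exprVn. Qed.

(* Constants for the pairs (y, Q_m), (y, Q'), (Q_m, Q_(m+1)) and (Q_0, Q'). *)
Let g1 := d%:R ^+ d * (d%:R * c0) `^ (s * p) / cw.
Let g2 := (d%:R * 2) `^ (d%:R + s * p) / cw * d%:R ^+ d.
Let g3 := d%:R ^+ d * d%:R `^ (s * p) * c0 `^ (s * p) / c0 ^+ d * 2 ^+ d / cw.
Let g4 := (d%:R * 3) `^ (d%:R + s * p) / cw / (c0 ^+ d * (d%:R^-1) ^+ d).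
Let G := g1 + g2 + g3 + g4.

Let g1_gt0 : 0 < g1.
Proof. by rewrite divr_gt0// mulr_gt0 ?exprn_gt0 ?powR_gt0// mulr_gt0. Qed.
Let g2_gt0 : 0 < g2.
Proof. by rewrite mulr_gt0 ?exprn_gt0// divr_gt0 ?powR_gt0// mulr_gt0. Qed.
Let g3_gt0 : 0 < g3.
Proof. by rewrite !(mulr_gt0, divr_gt0, exprn_gt0, powR_gt0, invr_gt0). Qed.
Let g4_gt0 : 0 < g4.
Proof. by rewrite !(mulr_gt0, divr_gt0, exprn_gt0, powR_gt0, invr_gt0). Qed.

(** [M^p] dominates each of the four constants, so all bounds between values and averages share the
    factor [2 M]. *)
Let M := G `^ p^-1.

Let M_ge0 : 0 <= M. Proof. exact: powR_ge0. Qed.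

Let Mp : M `^ p = G.
Proof.
rewrite -powRrM mulVf ?gt_eqF// powRr1//.
by rewrite !addr_ge0// ltW.
Qed.

Let powR_dN (a : R) : 0 < a ->
  a `^ (d%:R + s * p) = a ^+ d * a `^ (s * p).
Proof. by move=> a0; rewrite powRD ?(gt_eqF a0) ?implybT// powR_mulrn// ltW. Qed.

Let tau_gt0 m : 0 < (2^-1) ^+ m :> R.
Proof. by rewrite exprn_gt0// invr_gt0. Qed.

(** Both sides scale like [2^(-m(d+sp))], so one constant, [g1], serves for all [m]. *)
Let value_const m : (d%:R * (c0 * 2^-1 ^+ m)) `^ (d%:R + s * p) / cw <=
  (c0 * 2^-1 ^+ m) ^+ d * (M * (2 `^ (- s)) ^+ m) `^ p.
Proof.
have t0 := tau_gt0 m.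
rewrite powR_dN ?mulr_gt0// [X in _ <= _ * X]powRM// ?exprn_ge0 ?powR_ge0// Mp.
have -> : (d%:R * (c0 * 2^-1 ^+ m)) `^ (s * p) =
    (d%:R * c0) `^ (s * p) * (2^-1 ^+ m) `^ (s * p).
  by rewrite mulrA powRM// ltW// mulr_gt0.
have -> : ((2 `^ (- s)) ^+ m) `^ p = (2^-1 ^+ m) `^ (s * p) :> R.
  rewrite (exprn_powR2 (- s) m) (expr2V_powR m) -!powRrM; congr (_ `^ _); ring.
rewrite exprMn.
rewrite [leLHS](_ : _ = (c0 * 2^-1 ^+ m) ^+ d * (g1 * (2^-1 ^+ m) `^ (s * p)));
  last by rewrite /g1 !exprMn; field; rewrite gt_eqF.
rewrite ler_wpM2l ?exprn_ge0 ?mulr_ge0 ?(ltW c00) ?(ltW t0)//.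
rewrite ler_wpM2r ?powR_ge0// /G.
by have := (g2_gt0, g3_gt0, g4_gt0) => -[[]] *; lra.
Qed.

Let value_const' : (d%:R * 2) `^ (d%:R + s * p) / cw <= d%:R^-1 ^+ d * M `^ p.
Proof.
rewrite Mp exprVn ler_pdivlMl ?exprn_gt0// mulrC -/g2 /G.
by have := (g1_gt0, g3_gt0, g4_gt0) => -[[]] *; lra.
Qed.

Let average_const m : (d%:R * (c0 * 2^-1 ^+ m)) `^ (d%:R + s * p) / cw <=
  (c0 * 2^-1 ^+ m) ^+ d * (c0 * 2^-1 ^+ m.+1) ^+ d *
  (M * (2 `^ (d%:R / q)) ^+ m) `^ p.
Proof.
have t0 := tau_gt0 m.
(* This is the Sobolev condition multiplied by [p], that is [d - sp <= dp/q]. The ratio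
   [2^((d-sp)/p)] is relaxed to [2^(d/q)], which exceeds 1 even when [sp = d], so the sum over
   scales stays geometric. *)
have tT : (2^-1 ^+ m) `^ (s * p) <=
    (2^-1 ^+ m) ^+ d * ((2 `^ (d%:R / q)) ^+ m) `^ p :> R.
  rewrite (exprn_powR2 (d%:R / q) m) (expr2V_powR m).
  rewrite -(powR_mulrn d (powR_ge0 2 (- m%:R))) -!powRrM -powRD; last first.
    by rewrite pnatr_eq0 implybT.
  apply: ler_powR; first by rewrite ler1n.
  have := ler_wpM2r (ltW p0) sobolev; rewrite mulrBl divfK ?gt_eqF//.
  have m0 : 0 <= m%:R :> R by [].
  by move=> /(ler_wpM2l m0); lra.
rewrite powR_dN ?mulr_gt0// [X in _ <= _ * X]powRM// ?exprn_ge0 ?powR_ge0// Mp.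
have -> : (d%:R * (c0 * 2^-1 ^+ m)) `^ (s * p) =
    d%:R `^ (s * p) * c0 `^ (s * p) * (2^-1 ^+ m) `^ (s * p).
  by rewrite mulrA powRM ?powRM// ltW// mulr_gt0.
rewrite [leLHS](_ : _ = (c0 * 2^-1 ^+ m) ^+ d * (c0 * 2^-1 ^+ m.+1) ^+ d *
   (2^-1 ^+ m) ^- d * (g3 * (2^-1 ^+ m) `^ (s * p))); last first.
  rewrite /g3 exprS !exprMn !exprVn; field.
  by rewrite !gt_eqF// !exprn_gt0// mulr_gt0.
rewrite -mulrA ler_wpM2l//.
  by rewrite mulr_ge0// exprn_ge0// mulr_ge0// ltW.
rewrite mulrCA ler_pM ?(ltW g3_gt0) ?mulr_ge0 ?invr_ge0 ?exprn_ge0 ?powR_ge0//.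
  by rewrite /G; have := (g1_gt0, g2_gt0, g4_gt0) => -[[]] *; lra.
by rewrite ler_pdivrMl ?exprn_gt0.
Qed.

Let average_const' : (d%:R * 3) `^ (d%:R + s * p) / cw <=
  c0 ^+ d * d%:R^-1 ^+ d * M `^ p.
Proof.
have cd0 : 0 < c0 ^+ d * d%:R^-1 ^+ d.
  by rewrite mulr_gt0// exprn_gt0// invr_gt0.
rewrite Mp [leRHS]mulrC -ler_pdivrMr// -/g4 /G.
by have := (g1_gt0, g2_gt0, g3_gt0) => -[[]] *; lra.
Qed.

(** Meant for [b = y] and [b = D y], whose head norms are [h] and [2 h]; moving inside the cube
    costs a further factor 2, whence the 4. *)
Let cube_height (y b : 'rV[R]_d) r (h := head_norm k y) :
  h <= head_norm k b <= 2 * h -> 0 < r -> r <= c0 * head_norm k b ->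
  forall x, rV_cube b r x -> h / 4 <= head_norm k x <= 4 * h.
Proof.
move=> /andP[hb bh] r0 rb x Qx.
have rb' : r <= head_norm k b / (2 * d%:R) by rewrite mulrC.
have /andP[? ?] := head_norm_cube d0 (ltW r0) rb' Qx.
have h0 : 0 <= h by exact: head_norm_ge0.
by apply/andP; split; lra.
Qed.

(** The left side is [X^q g / h^gamma] with the [X] and [g] of the next proof; [gamma] is the
    exponent that makes [h] disappear. *)
Lemma scale_cancel (h e f : R) : 0 < h -> 0 < e ->
  ((h ^+ k * e / h ^+ d) `^ p^-1) `^ q * (h ^+ d * f / e) / h `^ gamma =
  e `^ (q / p - 1) * f.
Proof.
move=> h0 e0.
have -> : h ^+ k * e / h ^+ d = h `^ (k%:R - d%:R) * e.
  by rewrite powRD ?(gt_eqF h0) ?implybT// powRN !powR_mulrn ?(ltW h0)//; ring.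
rewrite -powRrM mulrC [p^-1 * q]mulrC powRM ?powR_ge0 ?(ltW e0)// -powRrM.
rewrite [h `^ (d%:R + _)]powRD ?(gt_eqF h0) ?implybT// powR_mulrn ?(ltW h0)//.
rewrite powRD ?(gt_eqF e0) ?implybT// powRN powRr1 ?(ltW e0)//.
have hz : h `^ ((k%:R - d%:R) * (q / p)) != 0 by rewrite gt_eqF// powR_gt0.
by field; rewrite hz !gt_eqF// exprn_gt0.
Qed.

(** The value at [y] is compared with a cube at [y] and with one at [D y]. The second cube is the
    first cube of the point [D y], so the bounds at [y] and [D y] can be chained. *)
Lemma pointwise_estimate : exists2 C, 0 < C & forall (u : 'rV[R]_d -> R) N,
  measurable_fun setT u -> (forall x, `|u x| <= N) ->
  forall e f y, let h := head_norm k y in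
  0 < e -> (\int[lebesgue_rV d]_y F u y <= e%:E)%E -> 0 < h -> F u y = f%:E ->
  `|u y - cube_average u y (c0 * h)| `^ q / h `^ gamma <=
    C * (e `^ (q / p - 1) * f) /\
  `|u y - cube_average u (head_dilation k y) (c0 * (2 * h))| `^ q / h `^ gamma <=
    C * (e `^ (q / p - 1) * f).
Proof.
pose H := 2 `^ s + (1 + (2 `^ (d%:R / q) - 1)^-1) : R.
pose C := 2 * M * H.
have H0 : 0 < H.
  rewrite addr_gt0 ?powR_gt0// addr_gt0// invr_gt0 subr_gt0.
  by rewrite powR_gt0E// expR_gt1 mulr_gt0 ?divr_gt0// ln_gt0// ltr1n.
exists (C `^ q); first by rewrite powR_gt0// !mulr_gt0// /M powR_gt0// !addr_gt0.
move=> u N mu uN e f y h e0 Fe h0 Ff.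
have f0 : 0 <= f by rewrite -lee_fin -Ff gagliardo_slice_ge0.
(* [X] measures the differences of averages allowed by the energy, and [Y = X g^(1/p)] the
   differences between value and average allowed by the slice; [g] plays the role of [h] in
   [hedberg_optimization]. *)
pose X := (h ^+ k * e / h ^+ d) `^ p^-1.
have X0 : 0 <= X by exact: powR_ge0.
have Xp : X `^ p * h ^+ d = h ^+ k * e.
  rewrite -powRrM mulVf ?gt_eqF// powRr1; last first.
    by rewrite divr_ge0 ?mulr_ge0 ?exprn_ge0// ltW.
  by rewrite divfK// gt_eqF// exprn_gt0.
pose g := h ^+ d * f / e.
have g0 : 0 <= g by rewrite divr_ge0 ?mulr_ge0 ?exprn_ge0// ltW.
pose Y := X * g `^ p^-1.
have Y0 : 0 <= Y by rewrite mulr_ge0// powR_ge0.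
have Yp : Y `^ p = h ^+ k * f.
  rewrite powRM ?powR_ge0// -[X in _ * X]powRrM mulVf ?gt_eqF// powRr1//.
  by rewrite /g mulrA mulrA Xp; field; rewrite gt_eqF.
pose A m := cube_average u y (c0 * 2^-1 ^+ m * h).
pose B := cube_average u (head_dilation k y) (d%:R^-1 * h).
have cB : c0 * (2 * h) = d%:R^-1 * h by rewrite /c0; field; rewrite gt_eqF.
have dV0 : 0 < d%:R^-1 :> R by rewrite invr_gt0.
have yh : h / 4 <= head_norm k y <= 4 * h by rewrite -/h; apply/andP; split; lra.
have ct0 m : 0 < c0 * 2^-1 ^+ m by rewrite mulr_gt0.
have ct_le m : c0 * 2^-1 ^+ m <= c0.
  by rewrite ler_piMr ?(ltW c00)// exprn_ile1// invf_le1// ler1n.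
have Ah m x : rV_cube y (c0 * 2^-1 ^+ m * h) x ->
    h / 4 <= head_norm k x <= 4 * h.
  apply: cube_height; rewrite -/h ?mulr_gt0//; first by apply/andP; split; lra.
  by rewrite ler_wpM2r// ltW.
have Bh x : rV_cube (head_dilation k y) (d%:R^-1 * h) x ->
    h / 4 <= head_norm k x <= 4 * h.
  apply: cube_height; rewrite ?head_norm_dilation -/h ?cB ?mulr_gt0//.
  by apply/andP; split; lra.
have Ad m x i : rV_cube y (c0 * 2^-1 ^+ m * h) x ->
    y ord0 i <= x ord0 i <= y ord0 i + c0 * 2^-1 ^+ m * h.
  by move=> /(_ i); rewrite /= in_itv.
have Bd x i : rV_cube (head_dilation k y) (d%:R^-1 * h) x ->
    `|x ord0 i - y ord0 i| <= 2 * h.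
  move=> Qx; apply: (dist_dilation_cube d0 _ _ Qx); first by rewrite mulr_ge0// ltW.
  by rewrite mulrC.
have uA m : `|u y - A m| <= 2 * M * ((2 `^ (- s)) ^+ m * Y).
  rewrite mulrA -(mulrA 2 M).
  apply: (cube_average_value_slice d0 s0 p1 cw0 w0 mw w_ge mu uN h0 (ct0 m)
    (ct0 m) _ Y0 yh _ Ff Yp (value_const m)).
    by rewrite mulr_ge0// exprn_ge0// powR_ge0.
  move=> x Qx; split=> [|i]; first exact: Ah Qx.
  by have /andP[? ?] := Ad _ _ i Qx; rewrite ler_norml; apply/andP; split; lra.
have uB : `|u y - B| <= 2 * M * Y.
  apply: (cube_average_value_slice d0 s0 p1 cw0 w0 mw w_ge mu uN h0 _
    dV0 M_ge0 Y0 yh _ Ff Yp value_const') => //.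
  by move=> x Qx; split=> [|i]; [exact: Bh|exact: Bd].
have AA m : `|A m - A m.+1| <= 2 * M * ((2 `^ (d%:R / q)) ^+ m * X).
  rewrite mulrA -(mulrA 2 M).
  apply: (cube_average_average_energy d0 s0 p1 cw0 w0 mw w_ge mu uN h0 (ct0 m)
    (ct0 m) (ct0 m.+1) _ X0 (Ah m) (Ah m.+1) _ (ltW e0) Fe Xp (average_const m)).
    by rewrite mulr_ge0// exprn_ge0// powR_ge0.
  move=> x z Qx Qz i; have /andP[? ?] := Ad _ _ i Qx.
  have /andP[? ?] := Ad _ _ i Qz.
  have : c0 * 2^-1 ^+ m.+1 * h <= c0 * 2^-1 ^+ m * h.
    rewrite ler_wpM2r ?(ltW h0)// ler_wpM2l ?(ltW c00)// exprS ler_piMl//.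
    by rewrite invf_le1// ler1n.
  by rewrite ler_norml; move=> ?; apply/andP; split; lra.
(* Coordinates of points of Q_0 and Q' differ by at most [c0 h + 2 h <= 3 h], whence the 3 in
   [g4]. *)
have AB : `|A 0%N - B| <= 2 * M * X.
  rewrite /A expr0 mulr1.
  apply: (cube_average_average_energy d0 s0 p1 cw0 w0 mw w_ge mu uN h0 _
    c00 dV0 M_ge0 X0 _ Bh _ (ltW e0) Fe Xp average_const') => //.
    by move=> x; have := @Ah 0 x; rewrite expr0 mulr1.
  move=> x z Qx Qz i; have := @Ad 0 x i; rewrite expr0 mulr1 => /(_ Qx) /andP[? ?].
  have := Bd z i Qz; rewrite ler_norml => /andP[? ?].
  have c01 : c0 * h <= h.
    rewrite ler_piMl ?(ltW h0)// invf_le1 ?mulr_gt0// -natrM ler1n muln_gt0.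
    by rewrite d0.
  by rewrite ler_norml; apply/andP; split; lra.
have MM : 0 <= 2 * M by rewrite mulr_ge0.
have fin Z : `|u y - Z| <= 2 * M * H * (X * g `^ q^-1) ->
    `|u y - Z| `^ q / h `^ gamma <= C `^ q * (e `^ (q / p - 1) * f).
  move=> /(le_powR (ltW q0) (normr_ge0 _)) uZ.
  have C0 : 0 <= C by rewrite mulr_ge0// ltW.
  rewrite -(scale_cancel f h0 e0) -/X -/g mulrA ler_wpM2r ?invr_ge0 ?powR_ge0//.
  rewrite (le_trans uZ)// powRM ?mulr_ge0 ?powR_ge0 ?(ltW H0)//.
  rewrite -/C ler_wpM2l ?powR_ge0// powRM ?powR_ge0//.
  by rewrite -[(g `^ _) `^ _]powRrM mulVf ?gt_eqF// powRr1.
have A0 : cube_average u y (c0 * h) = A 0%N by rewrite /A expr0 mulr1.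
(* In the first bound the target is [A 0] itself, so its distance to [A 0] is 0; in the second it is
   [B]. *)
split; apply: fin.
  rewrite A0; apply: (hedberg_optimization p0 pq s0 dR0 sobolev MM X0 g0 _ uA AA).
    by have := uA 0%N; rewrite expr0 mul1r.
  by rewrite subrr normr0 mulr_ge0.
by rewrite cB; apply: (hedberg_optimization p0 pq s0 dR0 sobolev MM X0 g0 uB uA AA).
Qed.

End pointwise.

(** * The weighted power integral *)

Section weighted_power_integral_theory.
Context {R : realType} {d : nat}.
Variables (k : nat) (q gam : R) (u : 'rV[R]_d -> R).
Hypothesis mu : measurable_fun setT u.

Definition weighted_power x : R := `|u x| `^ q / head_norm k x `^ gam.

Lemma weighted_power_ge0 x : 0 <= weighted_power x.
Proof. by rewrite divr_ge0// powR_ge0. Qed.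

Lemma measurable_weighted_power :
  measurable_fun setT (EFin \o weighted_power).
Proof.
apply/measurable_EFinP; apply: measurable_funM.
  rewrite [X in measurable_fun _ X](_ : _ = (@powR R ^~ q) \o (fun x => `|u x|))//.
  by apply: measurableT_comp; [exact: measurable_powR|exact: measurableT_comp].
rewrite [X in measurable_fun _ X](_ : _ =
  (@powR R ^~ (- gam)) \o (head_norm k)); last first.
  by apply/funext => z /=; rewrite powRN.
by apply: measurableT_comp; [exact: measurable_powR|exact: measurable_head_norm].
Qed.

Definition head_superlevel (t : R) : set 'rV[R]_d := [set x | t <= head_norm k x].

Lemma measurable_head_superlevel t : measurable (head_superlevel t).
Proof.
rewrite (_ : head_superlevel t = head_norm k @^-1` `[t, +oo[%classic).
  by rewrite -[X in measurable X]setTI; exact: measurable_head_norm.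
by apply/seteqP; split => x /=; rewrite in_itv/= andbT.
Qed.

(** Where [u] is nonzero on the superlevel set, [t <= |x_k| <= d N]: the weight is bounded there and
    the integrand vanishes outside a cube. *)
Lemma weighted_power_integral_superlevel_lty (t N : R) :
  0 < q -> 0 < t -> 0 < N ->
  (forall x, `|u x| <= N /\ (u x != 0 -> forall i, `|x ord0 i| <= N)) ->
  (\int[lebesgue_rV d]_(x in head_superlevel t) (weighted_power x)%:E < +oo)%E.
Proof.
move=> q0 t0 Npos uN; have mS := measurable_head_superlevel t.
have N0 := ltW Npos.
pose Q := rV_cube (\row_(i < d) - N) (2 * N) : set 'rV[R]_d.
have mQ : measurable Q by exact: measurable_rV_cube.
(* This [c] gives [t / c <= |x_k| <= c t], which controls the weight for either sign of [gam]. *)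
pose c := 1 + d%:R * N / t.
have c1 : 1 <= c by rewrite lerDl divr_ge0 ?mulr_ge0// ltW.
pose B := N `^ q / (c `^ (- `|gam|) * t `^ gam).
have c0 : 0 < c by rewrite (lt_le_trans ltr01).
have B0 : 0 <= B by rewrite divr_ge0 ?powR_ge0// mulr_ge0// powR_ge0.
have uQ x : u x != 0 -> Q x.
  move=> /(uN x).2 xN i; have := xN i.
  by rewrite /= in_itv/= mxE ler_norml => /andP[? ?]; apply/andP; split; lra.
have uB x : head_superlevel t x -> weighted_power x <= B * \1_Q x.
  rewrite /head_superlevel/= => tx; have [ux0|ux0] := eqVneq (u x) 0.
    by rewrite /weighted_power ux0 normr0 powR0 ?gt_eqF// mul0r mulr_ge0.
  rewrite indicE mem_set ?mulr1; last exact: uQ.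
  have xd : head_norm k x <= d%:R * N.
    apply: (@le_trans _ _ (enorm x)).
      rewrite /enorm /head_norm; apply: ler_wsqrtr.
      rewrite big_mkcond/=; apply: ler_sum => i _.
      by case: ifP => // _; exact: sqr_ge0.
    by apply: enorm_le => //; exact: (uN x).2.
  rewrite ler_pM ?powR_ge0 ?invr_ge0 ?powR_ge0//.
    by apply: le_powR => //; [exact: ltW|exact: (uN x).1].
  rewrite lef_pV2 ?posrE ?mulr_gt0 ?powR_gt0//; last exact: lt_le_trans tx.
  apply: powR_comparable => //; apply/andP; split.
    by apply: le_trans tx; rewrite ler_pdivrMr// ler_peMr// ltW.
  by rewrite (le_trans xd)// /c mulrDl mul1r divfK ?gt_eqF// lerDr ltW.
apply: (@le_lt_trans _ _ (\int[lebesgue_rV d]_(x in setT) (B%:E * (\1_Q x)%:E))%E).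
  apply: (@le_trans _ _ (\int[lebesgue_rV d]_(x in head_superlevel t)
      (B%:E * (\1_Q x)%:E))%E).
    apply: ge0_le_integral => //.
    - by move=> x _; rewrite lee_fin weighted_power_ge0.
    - by apply: measurable_funTS; exact: measurable_weighted_power.
    - apply: measurable_funTS; apply: measurable_funeM.
      by apply/measurable_EFinP; exact: measurable_indic.
  apply: ge0_subset_integral => //.
    by apply: measurable_funeM; apply/measurable_EFinP; exact: measurable_indic.
  by move=> x _; rewrite mule_ge0// lee_fin.
have mI : measurable_fun setT (fun x => (\1_Q x : R)%:E).
  by apply/measurable_EFinP; exact: measurable_indic.
rewrite ge0_integralZl ?lee_fin//.
have N20 : 0 < 2 * N by rewrite mulr_gt0.
rewrite integral_indic// setIT [X in (_ * X)%E](lebesgue_rV_cube _ N20).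
by rewrite -EFinM ltry.
Qed.

(** Monotone convergence along [t = 1/(n+1)]: these superlevel sets cover the complement of a null
    hyperplane. *)
Lemma weighted_power_integral_le (C : R) : (0 < k)%N -> (k <= d)%N ->
  (forall t, 0 < t ->
     (\int[lebesgue_rV d]_(x in head_superlevel t) (weighted_power x)%:E
      <= C%:E)%E) ->
  (weighted_power_integral q gam k u <= C%:E)%E.
Proof.
move=> k0 kd HC.
have d0 : (0 < d)%N by exact: leq_trans kd.
pose Z := [set x : 'rV[R]_d | x ord0 (Ordinal d0) = 0].
have mZ : measurable Z.
  rewrite -[Z]setTI; have m0 : measurable ([set 0] : set (measurableTypeR R)).
    exact: measurable_set1.
  exact: (@measurable_rV_coord R d (Ordinal d0) measurableT _ m0).
have m1 : measurable_fun setT (fun x => (weighted_power x)%:E).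
  exact: measurable_weighted_power.
have ge0 x : (0 <= (weighted_power x)%:E)%E by rewrite lee_fin weighted_power_ge0.
rewrite /weighted_power_integral.
rewrite (@ge0_negligible_integral _ _ _ _ _ Z)//; [|
  by move=> x _; exact: ge0|exact: lebesgue_rV_hyperplane].
pose S (n : nat) := head_superlevel n.+1%:R^-1.
have mS n : measurable (S n) by exact: measurable_head_superlevel.
apply: (@le_trans _ _
  (\int[lebesgue_rV d]_(x in \bigcup_n S n) (weighted_power x)%:E)%E).
  apply: ge0_subset_integral => //.
  - by apply: measurableD.
  - exact: bigcup_measurable.
  - exact: measurable_funTS.
  - by move=> x _; exact: ge0.
  move=> x [_ /= x0].
  have hx : 0 < head_norm k x.
    apply: lt_le_trans (normr_le_head_norm x (i := Ordinal d0) k0).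
    by rewrite normr_gt0; apply/eqP.
  exists (Num.truncn (head_norm k x)^-1) => //.
  rewrite /S /head_superlevel/= -[leRHS]invrK lef_pV2 ?posrE ?invr_gt0//.
  by rewrite ltW// truncnS_gt.
have ndS : nondecreasing_seq S.
  apply/nondecreasing_seqP => n; apply/subsetPset => x; rewrite /S /head_superlevel/=.
  by apply: le_trans; rewrite lef_pV2 ?posrE// ler_nat.
have cvS := @ge0_nondecreasing_set_cvg_integral _ _ _ S
  (fun x => (weighted_power x)%:E) (lebesgue_rV d) ndS mS
  (fun n => measurable_funTS m1) (fun n x _ => ge0 x).
rewrite -(cvg_lim _ cvS)//; apply: lime_le.
  by apply/cvg_ex; eexists; exact: cvS.
by apply: nearW => n; apply: HC; rewrite invr_gt0.
Qed.

End weighted_power_integral_theory.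

(** * Absorption by dilation *)

Section absorption.
Context {R : realType} {d k : nat}.
Variables (s p q cw : R) (w : 'rV[R]_d -> 'rV[R]_d -> R).
Hypotheses (k0 : (0 < k)%N) (kd : (k < d)%N).
Hypotheses (s0 : 0 < s) (p1 : 1 <= p) (cw0 : 0 < cw).
Hypotheses (pq : p < q) (sobolev : d%:R / p - s <= d%:R / q).
Hypothesis w0 : forall x y, 0 <= w x y.
Hypothesis mw :
  measurable_fun setT (fun z : 'rV[R]_d * 'rV[R]_d => w z.1 z.2).
Hypothesis w_ge : forall (h : R) x y, 0 < h ->
  h / 4 <= head_norm k x <= 4 * h -> h / 4 <= head_norm k y <= 4 * h ->
  cw * h `^ (s * p - k%:R) <= w x y.

Local Notation F := (gagliardo_slice s p w).
Local Notation gamma := (d%:R + (k%:R - d%:R) * (q / p)).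

Let d0 : (0 < d)%N. Proof. exact: leq_trans kd. Qed.
Let p0 : 0 < p. Proof. exact: lt_le_trans p1. Qed.
Let q0 : 0 < q. Proof. exact: lt_trans pq. Qed.

(** Both [u(y)] and [u(D y)] are compared with the average over one cube at [D y], by the second
    pointwise bound at [y] and the first at [D y]. *)
Lemma dilation_difference_le_slice : exists2 C, 0 < C &
  forall (u : 'rV[R]_d -> R) N,
  measurable_fun setT u -> (forall x, `|u x| <= N) ->
  forall e y, 0 < e -> (\int[lebesgue_rV d]_y F u y <= e%:E)%E ->
  0 < head_norm k y ->
  ((`|u y - u (head_dilation k y)| `^ q / head_norm k y `^ gamma)%:E <=
   (C * e `^ (q / p - 1))%:E * (F u y + F u (head_dilation k y)))%E.
Proof.
have [C C0 HC] := pointwise_estimate d0 s0 p1 cw0 pq sobolev w0 mw w_ge.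
have gp : 0 < 2 `^ gamma by rewrite powR_gt0.
exists (2 `^ q * (1 + 2 `^ gamma) * C).
  by rewrite !mulr_gt0 ?powR_gt0// addr_gt0.
move=> u N mu uN e y e0 Fe h0; set z := head_dilation k y.
have zh : head_norm k z = 2 * head_norm k y by rewrite head_norm_dilation.
have cp : (0 < 2 `^ q * (1 + 2 `^ gamma) * C * e `^ (q / p - 1)).
  by rewrite !mulr_gt0 ?powR_gt0// addr_gt0.
have Fy0 := gagliardo_slice_ge0 s p w0 u y.
have Fz0 := gagliardo_slice_ge0 s p w0 u z.
have [Foo|Ffin] := eqVneq (F u y + F u z)%E +oo%E.
  by rewrite Foo gt0_muley ?lte_fin// leey.
have : (F u y + F u z)%E \is a fin_num.
  rewrite ge0_fin_numE; last exact: adde_ge0.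
  by rewrite ltey.
rewrite fin_numD => /andP[/fineK Fy /fineK Fz].
move: Fy0 Fz0; rewrite -Fy -Fz.
move/esym: Fy; move/esym: Fz; move: (fine _) => f' Fz; move: (fine _) => f Fy.
rewrite !lee_fin => f0 f'0.
have [_ yB] := HC u N mu uN e f y e0 Fe h0 Fy.
have z0 : 0 < head_norm k z by rewrite zh mulr_gt0.
have [zB _] := HC u N mu uN e f' z e0 Fe z0 Fz.
move: zB; rewrite zh -/z; move: yB; rewrite -/z.
set B := cube_average _ _ _; set E := e `^ _; set g := head_norm k y `^ _.
have E0 : 0 < E by rewrite powR_gt0.
have g0 : 0 < g by rewrite powR_gt0.
rewrite powRM ?(ltW h0)// -/g => yB zB.
have {}zB : `|u z - B| `^ q / g <= 2 `^ gamma * (C * (E * f')).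
  by move: zB; rewrite invfM mulrCA ler_pdivrMl.
apply: (@le_trans _ _ (2 `^ q * (`|u y - B| `^ q / g + `|u z - B| `^ q / g))).
  by rewrite -mulrDl mulrA ler_wpM2r ?invr_ge0 ?(ltW g0)// powR_normB_le.
rewrite -!mulrA ler_wpM2l ?powR_ge0// (le_trans (lerD yB zB))//.
rewrite [leLHS](_ : _ = C * (E * f) + 2 `^ gamma * (C * (E * f')))//.
have CE0 : 0 <= C * E by rewrite mulr_ge0// ltW.
have := mulr_ge0 CE0 f0; have := mulr_ge0 CE0 f'0.
move=> Cf' Cf; have := mulr_ge0 (ltW gp) Cf; move: Cf Cf'; nra.
Qed.


(** Splitting [u] against its composition with D bounds the truncated integral by [eta < 1] times
    itself plus a multiple of [e^(q/p)]. As the truncated integral is finite, the first term is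
    absorbed. *)
Lemma weighted_power_integral_le_energy : exists2 C, 0 < C &
  forall (u : 'rV[R]_d -> R) N,
  measurable_fun setT u -> 0 < N ->
  (forall x, `|u x| <= N /\ (u x != 0 -> forall i, `|x ord0 i| <= N)) ->
  forall e, 0 < e -> (\int[lebesgue_rV d]_y F u y <= e%:E)%E ->
  (weighted_power_integral q gamma k u <= (C * e `^ (q / p))%:E)%E.
Proof.
have [C1 C10 HC1] := dilation_difference_le_slice.
(* Here [gamma - k = (d - k)(1 - q/p)]. *)
have gk : gamma < k%:R.
  have dk : k%:R < d%:R :> R by rewrite ltr_nat.
  have z1 : 1 < q / p by rewrite ltr_pdivlMr// mul1r.
  by nra.
(* Half of the gap [k - gamma] pays for the factor [(1 + kap)^q = 2^a] of the splitting; the other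
   half leaves [eta = 2^(-a)]. *)
pose a := (k%:R - gamma) / 2.
have a0 : 0 < a by rewrite divr_gt0// subr_gt0.
pose kap := 2 `^ (a / q) - 1 : R.
have kap0 : 0 < kap.
  by rewrite subr_gt0 powR_gt0E// expR_gt1 mulr_gt0 ?ln_gt0 ?ltr1n// divr_gt0.
have kapq : (1 + kap) `^ q = 2 `^ a.
  by rewrite /kap subrKC -powRrM divfK// gt_eqF.
pose eta := 2 `^ a * 2 `^ gamma * 2^-1 ^+ k : R.
have eta1 : eta < 1.
  rewrite /eta (expr2V_powR k) -!powRD ?pnatr_eq0 ?implybT//.
  rewrite powR_gt0E// expR_lt1 pmulr_llt0 ?ln_gt0 ?ltr1n//.
  by rewrite /a; lra.
pose C2 := (1 + kap^-1) `^ q * C1.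
have C20 : 0 < C2.
  by rewrite mulr_gt0// powR_gt0// addr_gt0// invr_gt0.
exists (2 * C2 / (1 - eta)); first by rewrite divr_gt0 ?subr_gt0// mulr_gt0.
move=> u N mu N0 uN e e0 Fe.
have {}HC1 := HC1 u N mu (fun x => (uN x).1) e _ e0 Fe.
set E := e `^ (q / p - 1) in HC1.
have E0 : 0 < E by rewrite powR_gt0.
apply: weighted_power_integral_le => // [|t t0]; first exact: ltnW.
set g := weighted_power k q gamma u.
have g0 x : (0 <= (g x)%:E)%E by rewrite lee_fin weighted_power_ge0.
have mg : measurable_fun setT (EFin \o g) by exact: measurable_weighted_power.
set S := head_superlevel k t.
have mS : measurable S by exact: measurable_head_superlevel.
pose phi : 'rV[R]_d -> \bar R := (EFin \o g) \_ S.
have mphi : measurable_fun setT phi.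
  by apply/(measurable_restrictT _ mS); exact: measurable_funTS.
have phi0 x : (0 <= phi x)%E by apply: erestrict_ge0 => z _; exact: g0.
have F0 x : (0 <= F u x)%E by exact: gagliardo_slice_ge0.
have mF : measurable_fun setT (F u) by exact: measurable_gagliardo_slice.
have mFD : measurable_fun setT (fun x => F u (head_dilation k x)).
  by apply: measurableT_comp => //; exact: measurable_head_dilation.
have mphiD : measurable_fun setT (fun x => phi (head_dilation k x)).
  by apply: measurableT_comp => //; exact: measurable_head_dilation.
have c0 : 0 <= 2 `^ a * 2 `^ gamma :> R by rewrite mulr_ge0 ?powR_ge0.
have CE0 : 0 <= C2 * E by rewrite mulr_ge0// ltW.
have phi_le y : (phi y <= (2 `^ a * 2 `^ gamma)%:E * phi (head_dilation k y) +
    (C2 * E)%:E * (F u y + F u (head_dilation k y)))%E.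
  rewrite {1}/phi patchE; case: ifPn => [|_]; last first.
    apply: adde_ge0; apply: mule_ge0; rewrite ?lee_fin//.
    exact: adde_ge0.
  rewrite inE /S/head_superlevel/= => ty.
  have h0 : 0 < head_norm k y by exact: lt_le_trans ty.
  (* D increases the head norm, so it maps the superlevel set into itself and the truncation
     survives. *)
  rewrite /phi patchE ifT; last first.
    rewrite inE /S/head_superlevel/= head_norm_dilation (le_trans ty)//.
    by rewrite ler_peMl ?ler1n// ltW.
  apply: (@le_trans _ _ ((2 `^ a * 2 `^ gamma)%:E * (g (head_dilation k y))%:E +
     ((1 + kap^-1) `^ q)%:E * (`|u y - u (head_dilation k y)| `^ q /
       head_norm k y `^ gamma)%:E)%E).
    rewrite -!EFinM -EFinD lee_fin /g /weighted_power head_norm_dilation.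
    have := powR_norm_split (u y) (u (head_dilation k y)) q0 kap0.
    rewrite kapq; set v1 := `|u y| `^ q; set v2 := `|u (head_dilation k y)| `^ q.
    set v3 := `|u y - _| `^ q.
    have h2 : 2 `^ gamma != 0 :> R by rewrite gt_eqF// powR_gt0.
    have hh : 0 < head_norm k y `^ gamma by rewrite powR_gt0.
    rewrite powRM ?(ltW h0)// => H.
    rewrite [leRHS](_ : _ = (2 `^ a * v2 + (1 + kap^-1) `^ q * v3) /
      head_norm k y `^ gamma); last by field; rewrite h2 gt_eqF.
    by rewrite ler_wpM2r// invr_ge0 ltW.
  apply: leeD2l; rewrite -[C2 * E]mulrA [X in (_ <= X * _)%E]EFinM -muleA.
  by rewrite lee_wpmul2l ?lee_fin ?powR_ge0//; exact: HC1.
have Phi_fin : (\int[lebesgue_rV d]_x phi x)%E \is a fin_num.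
  rewrite ge0_fin_numE; last exact: integral_ge0.
  rewrite /phi -integral_mkcond.
  exact: (weighted_power_integral_superlevel_lty _ _ mu q0 t0 N0 uN).
rewrite integral_mkcond -/phi.
have Phi_le : (\int[lebesgue_rV d]_x phi x <=
    eta%:E * \int[lebesgue_rV d]_x phi x + (2 * C2 * E * e)%:E)%E.
  have mFF : measurable_fun setT (fun x => (F u x + F u (head_dilation k x))%E).
    exact: emeasurable_funD.
  apply: (@le_trans _ _ (\int[lebesgue_rV d]_x
    ((2 `^ a * 2 `^ gamma)%:E * phi (head_dilation k x) +
     (C2 * E)%:E * (F u x + F u (head_dilation k x))))%E).
    apply: ge0_le_integral; [exact: measurableT|by move=> x _; exact: phi0|
      exact: mphi| |by move=> x _; exact: phi_le].
    by apply: emeasurable_funD; exact: measurable_funeM.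
  rewrite ge0_integralD//; last 4 first.
  - by move=> x _; rewrite mule_ge0 ?lee_fin.
  - exact: measurable_funeM.
  - by move=> x _; apply: mule_ge0; rewrite ?lee_fin//; exact: adde_ge0.
  - exact: measurable_funeM.
  rewrite ge0_integralZl ?lee_fin// ge0_integralZl ?lee_fin//; last first.
    by move=> x _; rewrite adde_ge0.
  rewrite ge0_integralD// !ge0_integral_head_dilation ?(ltnW kd)//.
  rewrite muleA -EFinM -/eta leeD2l//.
  (* One [e] bounds the integral of [F], the other that of [F] composed with D, which is smaller by
     the factor [2^-k]. *)
  rewrite (_ : 2 * C2 * E * e = C2 * E * (e + e)); last by ring.
  rewrite [leRHS]EFinM lee_wpmul2l ?lee_fin// EFinD leeD//.
  rewrite -[leRHS]mul1e lee_pmul ?lee_fin ?exprn_ge0 ?integral_ge0//.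
  by rewrite exprn_ile1// invf_le1// ler1n.
move: Phi_le; rewrite -(fineK Phi_fin) -EFinM -EFinD !lee_fin.
set r := fine _ => r_le.
have Ee : E * e = e `^ (q / p).
  rewrite /E -{2}[e](powRr1 (ltW e0)) -powRD ?subrK//.
  by rewrite (gt_eqF e0) implybT.
rewrite mulrAC ler_pdivlMr ?subr_gt0// -Ee.
by move: r_le; rewrite !mulrA; lra.
Qed.

End absorption.

(** * Homogeneous weights *)

Section homogeneous_weights.
Context {R : realType} {d k : nat}.

(** It remains to take roots. The previous bound concerns levels [e > 0] above the energy, so
    infinite and zero energy are treated apart. *)
Lemma weighted_hardy_sobolev (s p q cw : R) (w : 'rV[R]_d -> 'rV[R]_d -> R) :
  (0 < k)%N -> (k < d)%N -> 0 < s -> 1 <= p -> 0 < cw ->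
  p < q -> d%:R / p - s <= d%:R / q ->
  (forall x y, 0 <= w x y) ->
  measurable_fun setT (fun z : 'rV[R]_d * 'rV[R]_d => w z.1 z.2) ->
  (forall (h : R) x y, 0 < h ->
     h / 4 <= head_norm k x <= 4 * h -> h / 4 <= head_norm k y <= 4 * h ->
     cw * h `^ (s * p - k%:R) <= w x y) ->
  exists C : R, 0 < C /\ forall u : 'rV[R]_d -> R, C1c u ->
    (C%:E * poweR (weighted_power_integral q
              (d%:R + (k%:R - d%:R) * (q / p))%R k u) (q^-1)%R <=
     poweR (weighted_gagliardo s p w u) (p^-1)%R)%E.
Proof.
move=> k0 kd s0 p1 cw0 pq sob w0 mw w_ge.
have p0 : 0 < p by exact: lt_le_trans p1.
have q0 : 0 < q by exact: lt_trans pq.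
have [C C0 HC] :=
  weighted_power_integral_le_energy k0 kd s0 p1 cw0 pq sob w0 mw w_ge.
exists ((C `^ q^-1)^-1); split; first by rewrite invr_gt0 powR_gt0.
move=> u uC; have [N N0 uN] := C1c_bounded uC.
have mu : measurable_fun setT u.
  apply: continuous_measurable_rV => x; apply: differentiable_continuous.
  by case: uC => -[].
set gam := (d%:R + _)%R in HC *.
have E0 : (0 <= weighted_gagliardo s p w u)%E.
  by apply: integral_ge0 => y _; exact: (gagliardo_slice_ge0 s p w0 u y).
have U0 : (0 <= weighted_power_integral q gam k u)%E.
  by apply: integral_ge0 => y _; rewrite lee_fin divr_ge0// powR_ge0.
have {HC} := HC u N mu N0 uN.
rewrite -[X in forall e, _ -> (X <= _)%E -> _]/(weighted_gagliardo s p w u).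
move: E0 U0; case: weighted_gagliardo => [E| |]//; last first.
  by move=> _ _ _; rewrite poweRyr ?invr_eq0 ?gt_eqF// leey.
(* With finite energy [E], the bound at level [E + 1] rules out an infinite power integral. *)
case: weighted_power_integral => [U| |]//; last first.
  move=> E0 _ /(_ (E + 1)); rewrite lee_fin lerDl ler01 => /(_ _ isT).
  by rewrite lee_fin in E0; rewrite ltr_wpDl// => /(_ isT).
rewrite !lee_fin => E0 U0 HC.
have UE : U <= C * E `^ (q / p).
  (* At zero energy every positive level is admissible; the level [(e / C)^(p/q)] makes the bound
     equal to [e], which is arbitrary. *)
  move: E0; rewrite le_eqVlt => /predU1P[E0|E0]; last exact: HC.
  rewrite -E0 powR0 ?mulr0; last by rewrite gt_eqF// divr_gt0.
  apply/ler_addgt0Pl => e e0; rewrite addr0.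
  have eC : 0 < e / C by rewrite divr_gt0.
  have := HC ((e / C) `^ (p / q)).
  rewrite powR_gt0// -E0 lee_fin powR_ge0 => /(_ isT isT).
  rewrite lee_fin -powRrM (_ : p / q * (q / p) = 1); last first.
    by field; rewrite !gt_eqF.
  by rewrite powRr1 ?(ltW eC)// mulrC divfK// gt_eqF.
rewrite ler_pdivrMl ?powR_gt0//.
apply: (le_trans (le_powR _ U0 UE)); first by rewrite invr_ge0 ltW.
rewrite powRM ?powR_ge0 ?(ltW C0)// -powRrM.
by rewrite (_ : q / p / q = p^-1)//; field; rewrite !gt_eqF.
Qed.

Lemma measurable_head_norm_powR (a : R) :
  measurable_fun setT (fun x : 'rV[R]_d => head_norm k x `^ a).
Proof.
rewrite [X in measurable_fun _ X](_ : _ = (@powR R ^~ a) \o (head_norm k))//.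
by apply: measurableT_comp; [exact: measurable_powR|exact: measurable_head_norm].
Qed.

Lemma measurable_head_norm_powR_fst (a : R) :
  measurable_fun setT (fun z : 'rV[R]_d * 'rV[R]_d => head_norm k z.1 `^ a).
Proof. by apply: (measurableT_comp (measurable_head_norm_powR a)). Qed.

Lemma measurable_head_norm_powR_snd (a : R) :
  measurable_fun setT (fun z : 'rV[R]_d * 'rV[R]_d => head_norm k z.2 `^ a).
Proof. by apply: (measurableT_comp (measurable_head_norm_powR a)). Qed.

Lemma head_norm_powR_ge (a h : R) (x : 'rV[R]_d) : 0 < h ->
  h / 4 <= head_norm k x <= 4 * h ->
  4 `^ (- `|a|) * h `^ a <= head_norm k x `^ a.
Proof. by move=> h0 xh; apply: powR_comparable => //; rewrite ler1n. Qed.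

Lemma Wr_ge0 (e r : R) (x y : 'rV[R]_d) : 0 <= Wr e r k x y.
Proof. by rewrite /Wr mulr_ge0 ?powR_ge0// le_min !powR_ge0. Qed.

Lemma measurable_Wr (e r : R) :
  measurable_fun setT (fun z : 'rV[R]_d * 'rV[R]_d => Wr e r k z.1 z.2).
Proof.
apply: measurable_funM.
  apply: measurable_minr.
    exact: measurable_head_norm_powR_fst.
  exact: measurable_head_norm_powR_snd.
rewrite [X in measurable_fun _ X](_ : _ = (@powR R ^~ (r - 1)) \o
  (fun z : 'rV[R]_d * 'rV[R]_d =>
    Num.max (head_norm k z.1 `^ (- (e / r))) (head_norm k z.2 `^ (- (e / r)))))//.
apply: measurableT_comp; first exact: measurable_powR.
apply: measurable_maxr.
  exact: measurable_head_norm_powR_fst.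
exact: measurable_head_norm_powR_snd.
Qed.

(** The minimum and the power [r - 1] of the maximum act as [r] factors comparable to [h^(-e/r)], of
    total degree [-e]. *)
Lemma Wr_ge (e r h : R) (x y : 'rV[R]_d) (c := 4 `^ (- `|- (e / r)|)) :
  1 < r -> 0 < h ->
  h / 4 <= head_norm k x <= 4 * h -> h / 4 <= head_norm k y <= 4 * h ->
  c * c `^ (r - 1) * h `^ (- e) <= Wr e r k x y.
Proof.
move=> r1 h0 xh yh.
have cx := head_norm_powR_ge (- (e / r)) h0 xh.
have cy := head_norm_powR_ge (- (e / r)) h0 yh.
have ch0 : 0 <= c * h `^ (- (e / r)) by rewrite mulr_ge0// powR_ge0.
apply: (@le_trans _ _ (c * h `^ (- (e / r)) * (c * h `^ (- (e / r))) `^ (r - 1))).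
  rewrite le_eqVlt; apply/orP; left; apply/eqP.
  rewrite powRM ?powR_ge0// mulrACA -powRrM -powRD ?(gt_eqF h0) ?implybT//.
  congr (_ * (_ `^ _)); field; rewrite gt_eqF//.
  exact: lt_trans r1.
apply: ler_pM => //; first exact: powR_ge0.
  by rewrite le_min cx cy.
apply: le_powR => //; first by rewrite subr_ge0 ltW.
by rewrite le_max cx.
Qed.

End homogeneous_weights.

(** Both weights are homogeneous of degree [sp - k] in the head norms, with [p = 2] in the second,
    so both inequalities are instances of [weighted_hardy_sobolev]. *)
Theorem theorem1p4 (R : realType) (d k : nat) (s alpha beta : R)
    (hd : (2 <= d)%N) (hk1 : (1 <= k)%N) (hkd : (k < d)%N)
    (hs : 0 < s < 1) :
  (forall p q : R, 1 < p -> 1 < q -> s * p <= d%:R ->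
     (s * p < d%:R -> p < q /\ q <= d%:R * p / (d%:R - s * p)) ->
     (s * p = d%:R -> p < q) ->
     let theta := d%:R + (s * p - d%:R) * (q / p) in
     let w := fun x y : 'rV[R]_d =>
       head_norm k x `^ (- ((k%:R - alpha + beta - s * p) / 2)) *
       head_norm k y `^ (- ((k%:R + alpha - beta - s * p) / 2)) in
     exists C : R, 0 < C /\
       forall u : 'rV[R]_d -> R, C1c u ->
         (poweR (weighted_gagliardo s p w u) (p^-1)%R >=
          C%:E * poweR (weighted_power_integral q
                          (theta + (k%:R - s * p) * (q / p))%R k u)
                       (q^-1)%R)%E)
  /\
  (forall q' r : R, 2 < q' -> q' <= 2 * d%:R / (d%:R - 2 * s) -> 1 < r ->
     let theta' := d%:R + (2 * s - d%:R) * (q' / 2) in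
     let w := fun x y : 'rV[R]_d =>
       Wr (k%:R + alpha + beta - 2 * s) r k x y *
       head_norm k x `^ alpha * head_norm k y `^ beta in
     exists C : R, 0 < C /\
       forall u : 'rV[R]_d -> R, C1c u ->
         (poweR (weighted_gagliardo s 2 w u) (2^-1)%R >=
          C%:E * poweR (weighted_power_integral q'
                          (theta' + (k%:R - 2 * s) * (q' / 2))%R k u)
                       (q'^-1)%R)%E).
Proof.
move: hs => /andP[s0 s1].
have sobolev (p q : R) : 0 < p -> 0 < q -> s * p < d%:R ->
    q <= d%:R * p / (d%:R - s * p) -> d%:R / p - s <= d%:R / q.
  move=> p0 q0 spd; rewrite ler_pdivlMr ?subr_gt0// => qd.
  rewrite ler_pdivlMr// -(@ler_pM2r _ p)//.
  by rewrite (_ : _ * q * p = q * (d%:R - s * p))//; field; rewrite gt_eqF.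
split=> [p q p1 q1 spd spd_lt spd_eq theta w|q r q2 qd r1 theta w].
  have p0 : 0 < p by exact: lt_trans p1.
  have q0 : 0 < q by exact: lt_trans q1.
  have [pq sob] : p < q /\ d%:R / p - s <= d%:R / q.
    move: spd; rewrite le_eqVlt => /predU1P[spd|spd].
      split; first exact: spd_eq.
      by rewrite -spd mulfK ?gt_eqF// subrr divr_ge0 ?mulr_ge0// ltW.
    have [pq qd] := spd_lt spd; split => //; exact: sobolev.
  (* The parameter [s] cancels, leaving the exponent [gamma] of the general inequality. *)
  have -> : theta + (k%:R - s * p) * (q / p) = d%:R + (k%:R - d%:R) * (q / p).
    by rewrite /theta; ring.
  pose a := - ((k%:R - alpha + beta - s * p) / 2).
  pose b := - ((k%:R + alpha - beta - s * p) / 2).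
  apply: (@weighted_hardy_sobolev R d k s p q (4 `^ (- `|a|) * 4 `^ (- `|b|))) => //.
  - exact: ltW.
  - by move=> x y; rewrite mulr_ge0 ?powR_ge0.
  - apply: measurable_funM; first exact: measurable_head_norm_powR_fst.
    exact: measurable_head_norm_powR_snd.
  move=> h x y h0 xh yh.
  have -> : s * p - k%:R = a + b by rewrite /a /b; field.
  rewrite powRD ?(gt_eqF h0) ?implybT// mulrACA.
  by rewrite ler_pM ?mulr_ge0 ?powR_ge0 ?head_norm_powR_ge.
have q0 : 0 < q by exact: lt_trans q2.
have -> : theta + (k%:R - 2 * s) * (q / 2) = d%:R + (k%:R - d%:R) * (q / 2).
  by rewrite /theta; ring.
pose e := k%:R + alpha + beta - 2 * s.
(* [d >= 2] and [s < 1] place the second inequality in the subcritical case. *)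
have s2d : s * 2 < d%:R.
  have : 2%:R <= d%:R :> R by rewrite ler_nat.
  by lra.
pose c : R := 4 `^ (- `|- (e / r)|).
have c0 : 0 < c by rewrite powR_gt0.
apply: (@weighted_hardy_sobolev R d k s 2 q
  (c * c `^ (r - 1) * 4 `^ (- `|alpha|) * 4 `^ (- `|beta|))) => //.
- by rewrite ler1n.
- by rewrite !mulr_gt0 ?powR_gt0.
- by apply: sobolev => //; rewrite (mulrC s) (mulrC d%:R).
- move=> x y; apply: mulr_ge0; last exact: powR_ge0.
  by apply: mulr_ge0; [exact: Wr_ge0|exact: powR_ge0].
- apply: measurable_funM; last exact: measurable_head_norm_powR_snd.
  apply: measurable_funM; last exact: measurable_head_norm_powR_fst.
  exact: measurable_Wr.
move=> h x y h0 xh yh.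
have -> : s * 2 - k%:R = - e + alpha + beta by rewrite /e; ring.
have -> : h `^ (- e + alpha + beta) = h `^ (- e) * h `^ alpha * h `^ beta.
  by rewrite !powRD ?(gt_eqF h0) ?implybT.
rewrite [leLHS](_ : _ = c * c `^ (r - 1) * h `^ (- e) *
  (4 `^ (- `|alpha|) * h `^ alpha) * (4 `^ (- `|beta|) * h `^ beta)); last by ring.
have cr0 : 0 <= c * c `^ (r - 1) * h `^ (- e) by rewrite !mulr_ge0 ?powR_ge0.
have ah0 a : 0 <= 4 `^ (- `|a|) * h `^ a by rewrite mulr_ge0 ?powR_ge0.
apply: ler_pM => //; first exact: mulr_ge0; last exact: head_norm_powR_ge.
by apply: ler_pM => //; [exact: Wr_ge|exact: head_norm_powR_ge].
Qed.
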